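(* Let $q\ge 2$ be an integer, let $T=T_q$ be the homogeneous tree of degree $q+1$ with the canonical flow measure $\mu(x)=q^{\ell(x)}$, and let $\mathcal R=\nabla\mathcal L^{-1/2}$ be the Riesz transform associated with the flow Laplacian $\mathcal L$. Then $\mathcal R$ does not map $L^\infty(\mu)$ into $BMO(\mu)$; i.e. $\mathcal R$ does not extend to a bounded operator from $L^\infty(\mu)$ to $BMO(\mu)$: there is no constant $C<\infty$ such that $\|\mathcal R f\|_{BMO(\mu)}\le C\|f\|_{L^\infty(\mu)}$ for all $f\in L^2(\mu)\cap L^\infty(\mu)$.
   Context: $T=T_q$ ($q\ge2$ an integer) is the infinite tree in which every vertex has exactly $q+1$ neighbours, identified with its vertex set, with graph distance $d$. Fix a vertex $o$ and an infinite geodesic ray $\omega_*$ emanating from $o$. For $x\in T$ let $x\wedge\omega_*$ be the vertex of $\omega_*$ closest to $x$; the level of $x$ is $\ell(x)=d(o,x\wedge\omega_* )-d(x,x\wedge\omega_* )$. Each $x$ has a unique neighbour $\mathfrak p(x)$ (predecessor) with $\ell(\mathfrak p(x))=\ell(x)+1$; the other $q$ neighbours, of level $\ell(x)-1$, form the set $\mathfrak s(x)$ of successors. Write $x\ge y$ if $d(x,y)=\ell(x)-\ell(y)$. The measure $\mu$ on $T$ is $\mu(\{x\})=\mu(x)=q^{\ell(x)}$. For $f:T\to\mathbb C$ the flow gradient is $\nabla f(x)=f(x)-f(\mathfrak p(x))$. The flow Laplacian is $\mathcal L f(x)=f(x)-\frac{1}{2\sqrt q}\sum_{y\sim x}\frac{\mu(y)^{1/2}}{\mu(x)^{1/2}}f(y)$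 ($\sim$ denotes adjacency); equivalently $\mathcal L=\frac12\nabla^*\nabla$. It is bounded, nonnegative, self-adjoint and injective on $L^2(\mu)$; $\mathcal L^{-1/2}$ is defined by the Spectral Theorem, finitely supported functions are in its domain, and $\mathcal R=\nabla\mathcal L^{-1/2}$ extends to a bounded operator on $L^2(\mu)$. An admissible trapezoid is a subset $F\subset T$ which is either a singleton or of the form $F=F_{h'}^{h''}(x_0)=\{x\in T: x\le x_0,\ \ell(x_0)-h''<\ell(x)\le \ell(x_0)-h'\}$ for some $x_0\in T$ and positive integers $h',h''$ with $2\le h''/h'\le 12$; $\mathcal F$ is the family of all admissible trapezoids. For a function $f$ on $T$ and a finite set $F$, $f_F=\mu(F)^{-1}\sum_{x\in F}f(x)\mu(x)$. $BMO(\mu)$ is the space of functions $f$ on $T$ with $\|f\|_{BMO(\mu)}=\sup_{F\in\mathcal F}\frac1{\mu(F)}\sum_{x\in F}|f(x)-f_F|\,\mu(x)<\infty$. *)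

(* Defs.v *)
From HB Require Import structures.
From mathcomp Require Import all_boot all_order all_algebra.
From mathcomp Require Import complex.
From mathcomp Require Import all_classical all_reals all_analysis.
Set Implicit Arguments.
Unset Strict Implicit.
Unset Printing Implicit Defensive.
Import Order.TTheory GRing.Theory Num.Theory.
Import numFieldNormedType.Exports.
Local Open Scope classical_set_scope.
Local Open Scope complex_scope.
Local Open Scope ring_scope.

(* A connected acyclic simple graph, every vertex of which has exactly q + 1
   neighbours (given as duplicate-free sequences). *)
Structure homTree (q : nat) := HomTree {
  vertex :> choiceType ;
  nbrs : vertex -> seq vertex ;
  nbrs_uniq : forall x, uniq (nbrs x) ;
  nbrs_size : forall x, size (nbrs x) = q.+1 ;
  nbrs_irrefl : forall x, x \notin nbrs x ;
  nbrs_sym : forall x y, (y \in nbrs x) = (x \in nbrs y) ;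
  nbrs_connected : forall x y, exists p : seq vertex,
    path (fun u v => v \in nbrs u) x p /\ last x p = y ;
  (* a cycle of size 2 is an edge traversed back and forth *)
  nbrs_acyclic : forall c : seq vertex,
    ucycle (fun u v => v \in nbrs u) c -> (size c <= 2)%N
}.

Section Tree.
Context (q : nat) (T : homTree q).
Implicit Types x y : T.

Definition adj : rel T := fun x y => y \in nbrs x.

Lemma walk_length_ex x y : exists n : nat,
  `[< exists p : seq T, [/\ path adj x p, last x p = y & size p = n] >].
Proof.
have [p [xp py]] := nbrs_connected x y.
by exists (size p); apply/asboolP; exists p.
Qed.

Definition dist x y : nat := ex_minn (walk_length_ex x y).

Definition geodesic_ray (w : nat -> T) : Prop :=
  forall i j : nat, (i <= j)%N -> dist (w i) (w j) = (j - i)%N.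

Variable w : nat -> T.

(* x /\ w; the closest vertex is unique since T is a tree *)
Definition confluent x : T :=
  xget (w 0) [set v | range w v /\ forall n, (dist x v <= dist x (w n))%N].

Definition level x : int :=
  (dist (w 0) (confluent x))%:Z - (dist x (confluent x))%:Z.

(* for a geodesic ray w, x has exactly one neighbour of level (level x + 1) *)
Definition predecessor x : T :=
  xget x [set y | adj x y /\ level y = level x + 1].

(* y <= x in the order determined by w *)
Definition below y x : Prop := (dist x y)%:Z = level x - level y.

(* h1 = h' and h2 = h'' *)
Definition trapezoid (h1 h2 : nat) (x0 : T) : set T :=
  [set x | below x x0 /\ level x0 - h2%:Z < level x <= level x0 - h1%:Z].

Definition admissible (F : set T) : Prop :=
  (exists x0, F = [set x0]) \/
  exists (x0 : T) (h1 h2 : nat),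
    [/\ (0 < h1)%N, (0 < h2)%N, (2 * h1 <= h2 <= 12 * h1)%N
      & F = trapezoid h1 h2 x0].

Variable R : realType.
Implicit Types f g h : T -> R[i].

Definition mu x : R := q%:R ^ level x.

Definition gradient f : T -> R[i] := fun x => f x - f (predecessor x).

Definition flow_laplacian f : T -> R[i] := fun x =>
  f x - (2 * Num.sqrt (q%:R : R))^-1%:C *
        \sum_(y <- nbrs x) (Num.sqrt (mu y) / Num.sqrt (mu x))%:C * f y.

Definition normL2 f : \bar R :=
  sqrte (\esum_(x in [set: T]) ((Normc.normc (f x)) ^+ 2 * mu x)%:E).

Definition inL2 f : Prop := (normL2 f < +oo)%E.

(* mu charges every point, so the essential supremum is the supremum *)
Definition normLinf f : \bar R :=
  ereal_sup [set (Normc.normc (f x))%:E | x in [set: T]].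

Definition inLinf f : Prop := (normLinf f < +oo)%E.

Definition muset (F : set T) : R := \sum_(x \in F) mu x.

Definition average (F : set T) f : R[i] :=
  (muset F)^-1%:C * \sum_(x \in F) f x * (mu x)%:C.

Definition normBMO f : \bar R :=
  ereal_sup [set ((muset F)^-1 *
      \sum_(x \in F) Normc.normc (f x - average F f) * mu x)%:E
    | F in admissible].

Definition boundedL2 (A : (T -> R[i]) -> (T -> R[i])) : Prop :=
  (forall (a : R[i]) f g, inL2 f -> inL2 g ->
     A (fun x => a * f x + g x) = (fun x => a * A f x + A g x)) /\
  exists M : R, forall f, inL2 f -> (normL2 (A f) <= M%:E * normL2 f)%E.

Section Spectral.
Context (d : measure_display) (Y : measurableType d).
Variable nu : {measure set Y -> \bar R}.

Definition normL2_of (u : Y -> R[i]) : \bar R :=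
  sqrte (\int[nu]_s (Normc.normc (u s) ^+ 2)%:E).

Definition inL2_of (u : Y -> R[i]) : Prop :=
  [/\ measurable_fun [set: Y] (fun s : Y => complex.Re (u s)),
      measurable_fun [set: Y] (fun s : Y => complex.Im (u s))
    & (normL2_of u < +oo)%E].

(* Spectral Theorem in multiplication-operator form: U is a unitary map from
   L^2(mu) onto L^2(nu) (elements of the latter being functions up to nu-a.e.
   equality) which turns the bounded self-adjoint operator A into the
   multiplication by the real function m. *)
Definition diagonalizes (m : Y -> R) (U : (T -> R[i]) -> (Y -> R[i]))
    (A : (T -> R[i]) -> (T -> R[i])) : Prop :=
  measurable_fun [set: Y] m /\
  (forall f, inL2 f -> inL2_of (U f) /\ normL2_of (U f) = normL2 f) /\
  (forall (a : R[i]) f g, inL2 f -> inL2 g ->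
     {ae nu, forall s : Y, U (fun x => a * f x + g x) s = a * U f s + U g s}) /\
  (forall u, inL2_of u ->
     exists2 f, inL2 f & {ae nu, forall s : Y, U f s = u s}) /\
  (forall f, inL2 f -> {ae nu, forall s : Y, U (A f) s = (m s)%:C * U f s}).

(* Graph of phi(A): f is in the domain of phi(A) and h = phi(A) f, where
   phi(A) is the (possibly unbounded) operator U^-1 (phi o m) U. *)
Definition functional_calculus (m : Y -> R)
    (U : (T -> R[i]) -> (Y -> R[i])) (phi : R -> R) f h : Prop :=
  [/\ inL2 f, inL2 h & {ae nu, forall s : Y, U h s = (phi (m s))%:C * U f s}].

(* t^(-1/2); the junk value 0 at t <= 0 is harmless below because the flow
   Laplacian is nonnegative and injective *)
Definition inv_sqrt (t : R) : R := (Num.sqrt t)^-1.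

(* Rz is the bounded extension to L^2(mu) of gradient o L^(-1/2), which is
   unique because the domain of L^(-1/2) is dense. *)
Definition riesz_transform (m : Y -> R) (U : (T -> R[i]) -> (Y -> R[i]))
    (Rz : (T -> R[i]) -> (T -> R[i])) : Prop :=
  boundedL2 Rz /\
  forall f h, functional_calculus m U inv_sqrt f h -> Rz f = gradient h.

End Spectral.

End Tree.

(* Main.v *)
Require Import Defs.
From HB Require Import structures.
From mathcomp Require Import all_boot all_order all_algebra.
From mathcomp Require Import complex.
From mathcomp Require Import all_classical all_reals all_analysis.
From mathcomp Require Import measurable_realfun zify ring lra.
Set Implicit Arguments.
Unset Strict Implicit.
Unset Printing Implicit Defensive.
Import Order.TTheory GRing.Theory Num.Theory.
Import numFieldNormedType.Exports.
Local Open Scope classical_set_scope.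
Local Open Scope complex_scope.
Local Open Scope ring_scope.

(** Let [S f = f \o predecessor]. With respect to the flow measure [S] is an
    isometry, and the Laplacian is [L = 1 - (S + S^* ) / 2]. Let [x1] and [x2] be two
    successors of the same vertex and let [g] be the dipole, equal to [1] at [x1],
    to [-1] at [x2] and to [0] elsewhere. It is killed by [S^*], so the functions
    [S^n g] are orthogonal and span a copy of [l^2(nat)], on which [L] is the
    discrete Laplacian of the half line with a Dirichlet condition. There
    [L^(-1/2) g] decays only like [1 / n]. It is not summable; by self-adjointness
    [L^(-1/2)] sends some functions of that subspace bounded by [1] to functions
    that are arbitrarily large at [x1] and [x2], with opposite signs.

    The test functions are the waves [f = \sum_n r^n S^n g] with [0 < r < 1]. They
    are bounded by [1] and they solve [(L + s) f = g / (2 r)] with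
    [s = (1 - r)^2 / (2 r)] ([wave_resolvent]). If [h = L^(-1/2) f], the values of
    the gradient of [h] at [x1] and [x2] differ by [h x1 - h x2], since [x1] and [x2]
    have the same predecessor. As the successors of a vertex form an admissible
    trapezoid, this difference is controlled by the [BMO] norm of [R f]
    ([sibling_oscillation]). Up to constants it is the pairing of [h] with [g], that
    is, the integral of [t^(-1/2) / (t + s)] against the spectral measure [rho] of
    [g] ([wave_inverse_root]). A bound from [L^oo] to [BMO] would bound these
    integrals uniformly in [s].

    The Stieltjes transform of [rho] is explicit: the pairing of [f] with [g] gives
    the integral of [1 / (t + s)] against [rho], a constant times [r] ([wave_pairing]).
    It approaches its limit at [s = 0] at the rate [sqrt s], which is impossible if
    [t^(-3/2)] is [rho]-integrable ([integral_inv_sqrt_unbounded]).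

    That [rho] lives on the positive half line holds because [1 - L] is a
    contraction ([negative_spectrum]) and because an atom at [0] would make the
    integral of [1 / (t + s)] unbounded ([zero_spectrum]). *)

(** * Distances and levels in the tree *)

Section Distance.
Context (q : nat) (T : homTree q).
Implicit Types (x y z : T) (p : seq T).

Lemma adj_sym x y : adj x y = adj y x.
Proof. exact: nbrs_sym. Qed.

Lemma adj_neq x y : adj x y -> x != y.
Proof.
move=> xy; apply/eqP => exy; move: xy.
by rewrite /adj exy (negPf (nbrs_irrefl _)).
Qed.

Lemma reverse_walk x p : path (@adj q T) x p ->
  exists p', [/\ path (@adj q T) (last x p) p', last (last x p) p' = x,
    size p' = size p & {subset p' <= x :: p}].
Proof.
move=> xp; exists (rev (belast x p)); split.
- rewrite rev_path (eq_path (e' := @adj q T)) // => u v /=.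
  exact: adj_sym.
- by case: p {xp} => [//|a p] /=; rewrite rev_cons last_rcons.
- by rewrite size_rev size_belast.
- by move=> v; rewrite mem_rev; apply: mem_belast.
Qed.

Lemma dist_walk x y :
  exists p, [/\ path (@adj q T) x p, last x p = y & size p = dist x y].
Proof. by rewrite /dist; case: ex_minnP => n /asboolP. Qed.

Lemma dist_le_walk x p : path (@adj q T) x p -> (dist x (last x p) <= size p)%N.
Proof.
move=> xp; rewrite /dist; case: ex_minnP => n _; apply.
by apply/asboolP; exists p.
Qed.

Lemma distxx x : dist x x = 0%N.
Proof. by apply/eqP; rewrite -leqn0; apply: (@dist_le_walk x [::]). Qed.

Lemma dist_eq0 x y : dist x y = 0%N -> x = y.
Proof. by have [[|a p] [_ <- <-]] := dist_walk x y. Qed.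

Lemma distC x y : dist x y = dist y x.
Proof.
suff H (u v : T) : (dist u v <= dist v u)%N by apply/eqP; rewrite eqn_leq !H.
have [p [vp lp <-]] := dist_walk v u.
have [p' [pp' lp' sp' _]] := reverse_walk vp; rewrite -sp'.
by have := dist_le_walk pp'; rewrite lp' lp.
Qed.

Lemma adj_dist_le x y z : adj x y -> (dist x z <= (dist y z).+1)%N.
Proof.
move=> xy; have [p [yp <- <-]] := dist_walk y z.
by apply: (@dist_le_walk x (y :: p)); rewrite /= xy.
Qed.

Lemma dist1 x y : (dist x y = 1%N) <-> adj x y.
Proof.
split=> [|xy].
  have [[|a [|b p]] [/= ap <- <-]] := dist_walk x y => // _.
  by case/andP: ap.
apply/eqP; rewrite eqn_leq; apply/andP; split.
  by rewrite -[1%N](congr1 S (distxx y)); apply: adj_dist_le.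
by rewrite lt0n; apply: contraNneq (adj_neq xy) => /dist_eq0 ->.
Qed.

(** All later vertices of a shortest walk from [y] are closer to [z] than [x] is. *)
Lemma walk_avoiding x y z : x != y -> (dist y z <= dist x z)%N ->
  exists p, [/\ path (@adj q T) y p, last y p = z & x \notin y :: p].
Proof.
move=> xy yz; have [p [yp lp sp]] := dist_walk y z.
exists p; split => //; rewrite inE negb_or xy /=.
apply/negP => /splitPr xp; move: xp yp lp sp => [p1 p2].
rewrite cat_path last_cat size_cat /= => /andP[_ /andP[_ xp2]] lp sp.
have := dist_le_walk xp2; rewrite lp; lia.
Qed.

(** Two such neighbours could be joined by a walk avoiding [x], whose loop
    erasure would close up through [x] into a cycle. *)
Lemma closer_nbr_uniq x y y' z : adj x y -> adj x y' ->
  (dist y z <= dist x z)%N -> (dist y' z <= dist x z)%N -> y = y'.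
Proof.
move=> xy xy' dy dy'; apply/eqP/negPn/negP => yy'.
have [p [yp lp xp]] := walk_avoiding (adj_neq xy) dy.
have [p' [yp' lp' xp']] := walk_avoiding (adj_neq xy') dy'.
have [r [zr lr _ rs]] := reverse_walk yp'.
have ypr : path (@adj q T) y (p ++ r) by rewrite cat_path yp lp -lp'.
have lpr : last y (p ++ r) = y' by rewrite last_cat lp -lp' lr.
have xpr : x \notin y :: p ++ r.
  rewrite -cat_cons mem_cat negb_or xp /=.
  by apply: contra xp'; apply: rs.
case: (shortenP ypr) lpr => c yc uc sc lc.
have xc : x \notin y :: c.
  apply: contra xpr; rewrite !inE => /orP[->//|/sc xc].
  by apply/orP; right.
have := @nbrs_acyclic q T (x :: y :: c); case: c yc uc lc xc {sc}.
  by move=> _ _ /= e; rewrite e eqxx in yy'.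
move=> a c yc uc lc xc H; suff : false by []; apply: H.
apply/andP; split; last by rewrite cons_uniq xc.
rewrite (_ : cycle _ _ = path (@adj q T) x (rcons (y :: a :: c) x)) //.
move: lc yc => /= lc /andP[-> ac]; rewrite xy rcons_path ac lc.
by rewrite adj_sym xy'.
Qed.

Lemma closer_nbr x z : x != z -> exists2 y, adj x y & dist x z = (dist y z).+1.
Proof.
have [[|y p] [/= xp lp sp]] := dist_walk x z; first by rewrite lp eqxx.
move=> _; case/andP: xp => xy yp; exists y => //.
apply/eqP; rewrite eqn_leq adj_dist_le //= -sp ltnS -lp.
exact: dist_le_walk.
Qed.

Lemma nbr_dist_cases x y z : adj x y ->
  dist x z = (dist y z).+1 \/ dist y z = (dist x z).+1.
Proof.
move=> xy; have dx := adj_dist_le z xy.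
have dy : (dist y z <= (dist x z).+1)%N by apply: adj_dist_le; rewrite adj_sym.
suff : dist x z != dist y z by move: dx dy; lia.
apply/eqP => e; have [xz|xz] := eqVneq x z.
  move: e; rewrite xz distxx => /esym/dist_eq0 yz.
  by move: (adj_neq xy); rewrite xz yz eqxx.
have [y' xy' e'] := closer_nbr xz.
have := @closer_nbr_uniq x y y' z xy xy'.
rewrite -e leqnn e' => /(_ isT (leqnSn _)) yy'.
by move: e'; rewrite -yy' e; lia.
Qed.

End Distance.

Section Level.
Context (q : nat) (T : homTree q) (w : nat -> T) (hw : geodesic_ray w).
Implicit Types (x y z : T).

Lemma ray_adj n : adj (w n) (w n.+1).
Proof. by apply/dist1; rewrite hw // subSnn. Qed.

(** On a tree the distance to a point can only increase once it started to
    increase, since only one neighbour of [w n.+1] is closer to [x]. *)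
Lemma dist_ray_convex x n : dist x (w n.+1) = (dist x (w n)).+1 ->
  dist x (w n.+2) = (dist x (w n.+1)).+1.
Proof.
move=> e; have [|//] := nbr_dist_cases x (ray_adj n.+1); rewrite ![dist (w _) x]distC //.
move=> e'; have := @closer_nbr_uniq _ _ (w n.+1) (w n) (w n.+2) x.
rewrite adj_sym !ray_adj ![dist (w _) x]distC e leqnSn => /(_ isT isT isT).
have -> : (dist x (w n.+2) <= (dist x (w n)).+1)%N by lia.
move=> /(_ isT) e2; have := hw (leq_trans (leqnSn n) (leqnSn n.+1)).
rewrite -e2 distxx; lia.
Qed.

(** The level is a Busemann function: beyond its vertex closest to [x], the ray
    moves away from [x] by one at each step. *)
Lemma level_eventually x :
  exists N, forall n, (N <= n)%N -> level w x = n%:Z - (dist x (w n))%:Z.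
Proof.
have [k Dk ck] : exists2 k, forall n, (dist x (w k) <= dist x (w n))%N
    & confluent w x = w k.
  have [[k _ ek] Dk] : [set v | range w v /\
      forall n, (dist x v <= dist x (w n))%N] (confluent w x).
    have exD : exists d, `[< exists n, dist x (w n) = d >].
      by exists (dist x (w 0)); apply/asboolP; exists 0%N.
    case: (ex_minnP exD) => d /asboolP[k kd] dmin.
    apply: (@xgetPex _ (w 0)); exists (w k); split; first by exists k.
    by move=> n; rewrite kd; apply: dmin; apply/asboolP; exists n.
  by exists k; rewrite ek.
have Dj j : dist x (w (k + j).+1) = (dist x (w (k + j))).+1.
  elim: j => [|j IH]; last by rewrite addnS; apply: dist_ray_convex.
  rewrite addn0; have := nbr_dist_cases x (ray_adj k).
  by rewrite ![dist (w _) x]distC; have := Dk k.+1; lia.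
have DE j : dist x (w (k + j)) = (dist x (w k) + j)%N.
  by elim: j => [|j IH]; rewrite ?addn0 // !addnS Dj IH.
exists k => n kn; rewrite /level ck hw // -(subnKC kn) DE; lia.
Qed.

Lemma level_eventually_seq (s : seq T) : exists N, forall n, (N <= n)%N ->
  forall x, x \in s -> level w x = n%:Z - (dist x (w n))%:Z.
Proof.
elim: s => [|a s [N HN]]; first by exists 0%N.
have [N' HN'] := level_eventually a; exists (maxn N N') => n.
rewrite geq_max => /andP[nN nN'] x; rewrite inE => /predU1P[->|]; first exact: HN'.
exact: HN.
Qed.

(** Seen from a far point of the ray, the neighbours of [x] are one closer
    neighbour and [q] farther ones. *)
Lemma ex_predecessor x : exists2 y, adj x y /\ level w y = level w x + 1 &
  forall y', adj x y' -> y' != y -> level w y' = level w x - 1.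
Proof.
have [N HN] := level_eventually_seq (x :: nbrs x).
have [n Nn xn] : exists2 n, (N <= n)%N & x != w n.
  have [e|] := eqVneq x (w N); last by exists N.
  by exists N.+1 => //; rewrite e; exact: adj_neq (ray_adj N).
have [y xy e] := closer_nbr xn; exists y.
  split=> //; rewrite !(HN n Nn) ?inE ?eqxx ?xy ?orbT //; first lia.
  by apply/orP; right.
move=> y' xy' y'y; rewrite !(HN n Nn) ?inE ?eqxx ?orbT //; last first.
  by apply/orP; right.
have [e'|->] := nbr_dist_cases (w n) xy'; last by lia.
have := @closer_nbr_uniq _ _ x y y' (w n) xy xy'.
have -> : (dist y (w n) <= dist x (w n))%N by lia.
have -> : (dist y' (w n) <= dist x (w n))%N by lia.
move=> /(_ isT isT) yy'; by rewrite yy' eqxx in y'y.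
Qed.

Lemma predecessorP x :
  adj x (predecessor w x) /\ level w (predecessor w x) = level w x + 1.
Proof.
have [y Hy _] := ex_predecessor x.
by apply: (@xgetPex _ x [set y | adj x y /\ level w y = level w x + 1]); exists y.
Qed.

Lemma adj_predecessor x : adj x (predecessor w x).
Proof. by have [] := predecessorP x. Qed.

Lemma level_predecessor x : level w (predecessor w x) = level w x + 1.
Proof. by have [] := predecessorP x. Qed.

Lemma predecessor_eq x y :
  adj x y -> level w y = level w x + 1 -> predecessor w x = y.
Proof.
move=> xy ly; have [z [xz lz] H] := ex_predecessor x.
have eq_z v : adj x v -> level w v = level w x + 1 -> v = z.
  move=> xv lv; apply/eqP/negPn/negP => /(H _ xv); rewrite lv.
  by lia.
by rewrite (eq_z y) // (eq_z (predecessor w x)) // ?level_predecessor ?adj_predecessor.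
Qed.

Lemma predecessor_successor x y : adj x y -> y != predecessor w x ->
  predecessor w y = x.
Proof.
move=> xy yp; apply: predecessor_eq; first by rewrite adj_sym.
have [z [xz lz] H] := ex_predecessor x.
by rewrite (H y) ?subrK //; apply: contra yp => /eqP ->; rewrite (predecessor_eq xz).
Qed.

Lemma predecessorK_neq x : predecessor w (predecessor w x) != x.
Proof.
apply/eqP => /(congr1 (level w)); rewrite !level_predecessor; lia.
Qed.

Definition successors x : seq T := [seq y <- nbrs x | predecessor w y == x].

Lemma mem_successors x y : (y \in successors x) = (predecessor w y == x).
Proof.
rewrite mem_filter andb_idr // => /eqP <-.
by rewrite nbrs_sym; exact: adj_predecessor.
Qed.

Lemma perm_nbrs x : perm_eq (nbrs x) (predecessor w x :: successors x).
Proof.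
apply: uniq_perm; first exact: nbrs_uniq.
  rewrite cons_uniq filter_uniq ?nbrs_uniq // andbT mem_successors.
  exact: predecessorK_neq.
move=> y; rewrite inE mem_successors; apply/idP/predU1P.
  move=> xy; have [->|yp] := eqVneq y (predecessor w x); first by left.
  by right; apply/eqP; exact: predecessor_successor.
move=> [->|/eqP <-]; first exact: adj_predecessor.
by rewrite nbrs_sym; exact: adj_predecessor.
Qed.

Lemma size_successors x : size (successors x) = q.
Proof. by have := perm_size (perm_nbrs x); rewrite nbrs_size => -[]. Qed.

Lemma successors_uniq x : uniq (successors x).
Proof. by rewrite filter_uniq ?nbrs_uniq. Qed.

Lemma successors_trapezoid x : trapezoid w 1 2 x = [set` successors x].
Proof.
apply/seteqP; split=> y /=; rewrite /trapezoid /below /= mem_successors.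
  move=> [e H]; have : dist x y = 1%N by move: e H; lia.
  move=> xy1; apply/eqP/predecessor_eq; first by apply/dist1; rewrite distC.
  by move: e; rewrite xy1; lia.
move=> /eqP <-; rewrite !level_predecessor.
have -> : dist (predecessor w y) y = 1%N by apply/dist1; rewrite adj_sym adj_predecessor.
by lia.
Qed.

End Level.

(** * Squared moduli *)

Section SquareNorm.
Context (R : realType).
Implicit Types (z : R[i]) (a : R).

Lemma normc2E z : Normc.normc z ^+ 2 = complex.Re z ^+ 2 + complex.Im z ^+ 2.
Proof. by case: z => a b /=; rewrite sqr_sqrtr // addr_ge0 ?sqr_ge0. Qed.

Lemma normcR a : Normc.normc a%:C = `|a|.
Proof. by rewrite /= expr0n /= addr0 sqrtr_sqr. Qed.

Lemma normc2R a : Normc.normc a%:C ^+ 2 = a ^+ 2.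
Proof. by rewrite normcR real_normK ?num_real. Qed.

Lemma normc2M z z' :
  Normc.normc (z * z') ^+ 2 = Normc.normc z ^+ 2 * Normc.normc z' ^+ 2.
Proof. by rewrite Normc.normcM exprMn. Qed.

Lemma normc_ge0 z : 0 <= Normc.normc z.
Proof. by case: z => a b; exact: sqrtr_ge0. Qed.

Lemma normc_sum (I : Type) (s : seq I) (F : I -> R[i]) :
  Normc.normc (\sum_(i <- s) F i) <= \sum_(i <- s) Normc.normc (F i).
Proof.
elim: s => [|i s IH]; first by rewrite !big_nil Normc.normc0.
by rewrite !big_cons (le_trans (le_normcD _ _)) // lerD2l.
Qed.

Lemma sqr_sum_le (I : Type) (s : seq I) (u : I -> R) :
  (\sum_(i <- s) u i) ^+ 2 <= (size s)%:R * \sum_(i <- s) u i ^+ 2.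
Proof.
elim: s => [|i s IH]; first by rewrite !big_nil expr0n mul0r.
rewrite !big_cons /= -natr1.
have : 2 * u i * \sum_(j <- s) u j <= (size s)%:R * u i ^+ 2 + \sum_(j <- s) u j ^+ 2.
  elim: s {IH} => [|j s IH]; first by rewrite !big_nil mulr0 mul0r addr0.
  rewrite !big_cons /= -natr1; have := sqr_ge0 (u i - u j); lra.
by move: IH; lra.
Qed.

End SquareNorm.

(** * The flow measure *)

Section FlowMeasure.
Context (R : realType) (q : nat) (hq : (2 <= q)%N) (T : homTree q).
Context (w : nat -> T) (hw : geodesic_ray w).
Implicit Types (x y : T) (phi : T -> R).

Lemma q_gt0 : 0 < q%:R :> R.
Proof. by rewrite ltr0n (leq_trans _ hq). Qed.

Lemma mu_gt0 x : 0 < mu w R x.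
Proof. by rewrite exprz_gt0 ?q_gt0. Qed.

Lemma mu_predecessor x : mu w R (predecessor w x) = q%:R * mu w R x.
Proof.
by rewrite /mu level_predecessor // exprzDr ?unitfE ?lt0r_neq0 ?q_gt0 // mulrC expr1z.
Qed.

Lemma mu_successor x y : y \in successors w x -> mu w R y = q%:R^-1 * mu w R x.
Proof.
rewrite mem_successors // => /eqP <-.
by rewrite mu_predecessor mulKf // lt0r_neq0 ?q_gt0.
Qed.

Definition mass phi : \bar R := \esum_(x in [set: T]) (phi x * mu w R x)%:E.

Lemma mass_ge0 phi : (forall x, 0 <= phi x) -> (0 <= mass phi)%E.
Proof.
by move=> phi0; apply: esum_ge0 => x _; rewrite lee_fin mulr_ge0 // ltW ?mu_gt0.
Qed.

Lemma eq_mass phi phi' : phi =1 phi' -> mass phi = mass phi'.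
Proof. by move=> e; apply: eq_esum => x _; rewrite e. Qed.

Lemma le_mass phi phi' : (forall x, phi x <= phi' x) -> (mass phi <= mass phi')%E.
Proof.
by move=> e; apply: le_esum => x _; rewrite lee_fin ler_wpM2r // ltW ?mu_gt0.
Qed.

Lemma massD phi phi' : (forall x, 0 <= phi x) -> (forall x, 0 <= phi' x) ->
  mass (fun x => phi x + phi' x) = (mass phi + mass phi')%E.
Proof.
move=> p0 p0'; rewrite /mass -esumD.
- by apply: eq_esum => x _; rewrite mulrDl EFinD.
- by move=> x _; rewrite lee_fin mulr_ge0 // ltW ?mu_gt0.
- by move=> x _; rewrite lee_fin mulr_ge0 // ltW ?mu_gt0.
Qed.

Lemma mass_scale_le (a : R) phi : 0 <= a -> (forall x, 0 <= phi x) ->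
  (mass (fun x => a * phi x)%R <= a%:E * mass phi)%E.
Proof.
move=> a0 phi0; rewrite ge_ereal_sup //= => _ [X [finX XI]] <-.
rewrite (eq_fsbigr (fun x => a%:E * (phi x * mu w R x)%:E)%E); last first.
  by move=> x _; rewrite -EFinM mulrA.
rewrite -ge0_mule_fsumr; last first.
  by move=> x; rewrite lee_fin mulr_ge0 // ltW ?mu_gt0.
by rewrite lee_wpmul2l ?lee_fin // esum_ge //; exists X.
Qed.

(** Every vertex is a successor of exactly one vertex. *)
Lemma esum_successors (k : T -> T -> \bar R) : (forall x y, (0 <= k x y)%E) ->
  \esum_(x in [set: T]) (\sum_(y <- successors w x) k x y)%E =
  \esum_(y in [set: T]) k (predecessor w y) y.
Proof.
move=> k0.
transitivity (\esum_(x in [set: T]) \esum_(y in [set` successors w x]) k x y).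
  apply: eq_esum => x _; rewrite esum_fset //.
  by rewrite -fsbig_seq // successors_uniq.
rewrite esum_esum //.
rewrite (@reindex_esum _ _ _ [set: T] _ (fun y => (predecessor w y, y))) //.
split=> [y _ /=|y y' _ _ [_ ->] //|[x y] [_ /=]].
  by split=> //=; rewrite mem_successors.
by rewrite mem_successors // => /eqP <-; exists y.
Qed.

(** [f |-> f \o predecessor] is an isometry: each vertex has [q] successors,
    and each of them has [1/q] of its measure. *)
Lemma mass_predecessor phi : (forall x, 0 <= phi x) ->
  mass (phi \o predecessor w) = mass phi.
Proof.
move=> phi0; have mu0 x := ltW (mu_gt0 x).
rewrite /mass /= -(@esum_successors (fun x y => (phi x * mu w R y)%:E)); last first.
  by move=> x y; rewrite lee_fin mulr_ge0.
apply: eq_esum => x _; rewrite sumEFin big_seq.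
under eq_bigr => y /mu_successor -> do [].
rewrite -big_seq big_const_seq count_predT size_successors // iter_addr_0.
by rewrite -mulr_natr; congr _%:E; field; rewrite lt0r_neq0 ?q_gt0.
Qed.

(** The average over successors is the adjoint of the isometry
    [f |-> f \o predecessor]. *)
Lemma mass_successors phi : (forall x, 0 <= phi x) ->
  mass (fun x => q%:R^-1 * \sum_(y <- successors w x) phi y) = mass phi.
Proof.
move=> phi0; have mu0 x := ltW (mu_gt0 x).
rewrite /mass.
transitivity (\esum_(x in [set: T])
    (\sum_(y <- successors w x) (q%:R^-1 * phi y * mu w R x)%:E)%E).
  apply: eq_esum => x _; rewrite sumEFin; congr _%:E.
  by rewrite mulr_sumr mulr_suml.
rewrite (@esum_successors (fun x y => (q%:R^-1 * phi y * mu w R x)%:E)); last first.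
  by move=> x y; rewrite lee_fin !mulr_ge0 // invr_ge0.
apply: eq_esum => y _; rewrite mu_predecessor; congr _%:E.
by field; rewrite lt0r_neq0 ?q_gt0.
Qed.

End FlowMeasure.

(** * The flow Laplacian and the contraction [1 - L] *)

Lemma sqrte_lty (R : realType) (x : \bar R) :
  (0 <= x)%E -> (sqrte x < +oo)%E = (x < +oo)%E.
Proof. by case: x => [r| |] //=; rewrite !ltry. Qed.

Section Laplacian.
Context (R : realType) (q : nat) (hq : (2 <= q)%N) (T : homTree q).
Context (w : nat -> T) (hw : geodesic_ray w).
Implicit Types (x y : T) (f g h : T -> R[i]) (phi : T -> R).

Let q0 : 0 < q%:R :> R := q_gt0 R hq.
Let mu0 x : 0 < mu w R x := mu_gt0 R hq w x.

Definition energy f : \bar R := mass w (fun x => Normc.normc (f x) ^+ 2).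

Lemma normL2E f : normL2 w f = sqrte (energy f).
Proof. by []. Qed.

Lemma energy_ge0 f : (0 <= energy f)%E.
Proof. by apply: mass_ge0 => // x; exact: sqr_ge0. Qed.

Lemma inL2E f : inL2 w f <-> (energy f < +oo)%E.
Proof. by rewrite /inL2 normL2E sqrte_lty // energy_ge0. Qed.

(** The self-adjoint part of the isometry [f |-> f \o predecessor]. *)
Definition flow_average f : T -> R[i] := fun x =>
  2^-1%:C * f (predecessor w x) +
  (2 * q%:R)^-1%:C * \sum_(y <- successors w x) f y.

Lemma flow_laplacianE f x : flow_laplacian w f x = f x - flow_average f x.
Proof.
rewrite /flow_laplacian; congr (_ - _).
rewrite (perm_big _ (perm_nbrs hw x)) /= big_cons mu_predecessor // mulrDr.
have muN x' : Num.sqrt (mu w R x') != 0 by rewrite gt_eqF // sqrtr_gt0.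
have sq0 : Num.sqrt (q%:R : R) != 0 by rewrite gt_eqF // sqrtr_gt0.
congr (_ + _).
  rewrite mulrA -rmorphM /=; congr (_%:C * _).
  by rewrite sqrtrM ?ltW //; field; rewrite muN.
rewrite !mulr_sumr; apply: eq_big_seq => y /(mu_successor R hq hw) ->.
rewrite mulrA -rmorphM /=; congr (_%:C * _).
rewrite sqrtrM ?invr_ge0 ?ltW // sqrtrV ?ltW //.
have sqq : Num.sqrt (q%:R : R) ^+ 2 = q%:R by rewrite sqr_sqrtr ?ltW.
by rewrite -[in RHS]sqq; field; rewrite ?muN ?sq0.
Qed.

(** Both halves of the average preserve the mass of [|f|^2], so convexity of the
    square makes the average a contraction of [L^2]. *)
Lemma energy_flow_average f : (energy (flow_average f)
  <= energy f)%E.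
Proof.
pose phi x := 2^-1 * Normc.normc (f x) ^+ 2.
have phi0 x : 0 <= phi x by rewrite mulr_ge0 ?invr_ge0 ?sqr_ge0.
have -> : energy f = mass w (fun x => phi x + phi x).
  by apply: eq_mass => x; rewrite /phi -mulrDl -[LHS]mul1r; congr (_ * _); field.
rewrite massD // -{1}(mass_predecessor hq hw phi0) -(mass_successors hq hw phi0).
rewrite -massD // => [|x|x]; [|exact: phi0|]; last first.
  by rewrite mulr_ge0 ?sumr_ge0 // invr_ge0 ltW.
apply: le_mass => // x; rewrite /flow_average /phi /=.
set a := f (predecessor w x); set s := successors w x.
have ss : size s = q by apply: size_successors.
set v := \sum_(y <- s) Normc.normc (f y).
have H1 : Normc.normc (2^-1%:C * a + (2 * q%:R)^-1%:C * \sum_(y <- s) f y) <=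
    2^-1 * Normc.normc a + (2 * q%:R)^-1 * v.
  rewrite (le_trans (le_normcD _ _)) // !Normc.normcM !normcR.
  have q2 : 0 <= (2 * q%:R)^-1 :> R by rewrite invr_ge0 mulr_ge0 // ltW.
  have -> : `|2^-1| = 2^-1 :> R by rewrite ger0_norm // invr_ge0.
  by rewrite (ger0_norm q2) lerD2l ler_wpM2l // normc_sum.
have H2 := sqr_sum_le s (fun y => Normc.normc (f y)).
have n0 := normc_ge0.
have v0 : 0 <= v by rewrite sumr_ge0.
apply: (@le_trans _ _ ((2^-1 * Normc.normc a + (2 * q%:R)^-1 * v) ^+ 2)).
  by rewrite ler_pXn2r // ?nnegrE // addr_ge0 // mulr_ge0 // invr_ge0 mulr_ge0 // ltW.
move: H2; rewrite ss -mulr_sumr -/v.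
set V := \sum_(y <- s) Normc.normc (f y) ^+ 2 => H2.
have H3 : (q%:R^-1 * v) ^+ 2 <= q%:R^-1 * V.
  by rewrite exprMn expr2 -mulrA ler_pM2l ?invr_gt0 // mulrC ler_pdivrMr // mulrC.
rewrite invfM -mulrA.
have := sqr_ge0 (Normc.normc a - q%:R^-1 * v).
by move: H3; set u := q%:R^-1 * v; rewrite [q%:R^-1 * (_ * _)]mulrCA; lra.
Qed.

Lemma inL2_flow_average f : inL2 w f -> inL2 w (flow_average f).
Proof. by rewrite !inL2E; apply: le_lt_trans; exact: energy_flow_average. Qed.

Lemma inL2_comb (a : R[i]) f g : inL2 w f -> inL2 w g ->
  inL2 w (fun x => a * f x + g x).
Proof.
rewrite !inL2E => fL gL.
pose A := 2 * Normc.normc a ^+ 2.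
have A0 : 0 <= A by rewrite mulr_ge0 ?sqr_ge0.
apply: (@le_lt_trans _ _ (mass w (fun x => A * Normc.normc (f x) ^+ 2 +
    2 * Normc.normc (g x) ^+ 2))).
  apply: le_mass => // x; rewrite /A -mulrA -normc2M.
  set u := a * f x; have := le_normcD u (g x).
  have := normc_ge0 (u + g x); have := normc_ge0 u; have := normc_ge0 (g x).
  have := sqr_ge0 (Normc.normc u - Normc.normc (g x)).
  by move=> h1 h2 h3 h4 h5; nra.
rewrite massD //; last 2 first.
  by move=> x; rewrite mulr_ge0 ?sqr_ge0.
  by move=> x; rewrite mulr_ge0 ?sqr_ge0.
apply: lte_add_pinfty; apply: le_lt_trans (mass_scale_le hq w _ _) _ => //.
- by move=> x; exact: sqr_ge0.
- by rewrite lte_mul_pinfty // ?lee_fin.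
- by move=> x; exact: sqr_ge0.
- by rewrite lte_mul_pinfty // ?lee_fin.
Qed.

Lemma inL2_flow_laplacian f : inL2 w f -> inL2 w (flow_laplacian w f).
Proof.
move=> fL; have -> : flow_laplacian w f = fun x => -1 * flow_average f x + f x.
  by apply/funext => x; rewrite flow_laplacianE mulN1r addrC.
by apply: inL2_comb => //; exact: inL2_flow_average.
Qed.

End Laplacian.

(** * Resolvents of a dipole *)

Definition siblings (q : nat) (T : homTree q) (w : nat -> T) (x1 x2 : T) : Prop :=
  x1 != x2 /\ predecessor w x1 = predecessor w x2.

Section Siblings.
Context (R : realType) (q : nat) (hq : (2 <= q)%N) (T : homTree q).
Context (w : nat -> T) (hw : geodesic_ray w).
Context (x1 x2 : T) (sib : siblings w x1 x2).
Implicit Types (x y : T) (f h : T -> R[i]) (r : R).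

Let q0 : 0 < q%:R :> R := q_gt0 R hq.
Let mu0 x : 0 < mu w R x := mu_gt0 R hq w x.

Lemma siblings_neq : x1 != x2.
Proof. by case: sib. Qed.

Lemma siblings_predecessor : predecessor w x1 = predecessor w x2.
Proof. by case: sib. Qed.

Definition dipole x : R := (x == x1)%:R - (x == x2)%:R.

Lemma level_siblings : level w x2 = level w x1.
Proof.
have := level_predecessor hw x1.
by rewrite siblings_predecessor level_predecessor // => /addIr.
Qed.

Lemma mu_siblings : mu w R x2 = mu w R x1.
Proof. by rewrite /mu level_siblings. Qed.

Lemma dipole_x1 : dipole x1 = 1.
Proof. by rewrite /dipole eqxx (negPf siblings_neq) subr0. Qed.

Lemma dipole_x2 : dipole x2 = -1.
Proof. by rewrite /dipole eqxx eq_sym (negPf siblings_neq) sub0r. Qed.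

Lemma dipole_out x : x != x1 -> x != x2 -> dipole x = 0.
Proof. by move=> /negPf n1 /negPf n2; rewrite /dipole n1 n2 subrr. Qed.

Lemma dipole_neq0 x : dipole x != 0 -> level w x = level w x1.
Proof.
have [->//|n1] := eqVneq x x1; have [->|n2] := eqVneq x x2.
  by rewrite level_siblings.
by rewrite dipole_out // eqxx.
Qed.

Lemma dipole_norm x : `|dipole x| <= 1.
Proof.
have [->|n1] := eqVneq x x1; first by rewrite dipole_x1 normr1.
have [->|n2] := eqVneq x x2; first by rewrite dipole_x2 normrN1.
by rewrite dipole_out // normr0.
Qed.

(** The dipole is orthogonal to all functions of the form [f \o predecessor]; the
    subspace that the Laplacian generates from it is a copy of [l^2(nat)]. *)
Lemma sum_dipole_successors x : \sum_(y <- successors w x) dipole y = 0.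
Proof.
rewrite /dipole sumrB.
have H z : \sum_(y <- successors w x) (y == z)%:R = (predecessor w z == x)%:R :> R.
  rewrite -mem_successors // -(count_uniq_mem _ (successors_uniq w x)).
  by rewrite -natr_sum -sum1_count [in RHS]big_mkcond.
by rewrite !H siblings_predecessor subrr.
Qed.

(** The sum over [n] of [r ^ n] times the dipole moved [n] generations down, as
    the law [wave_rec] expresses. *)
Definition wave r x : R :=
  if level w x <= level w x1 then
    let n := `|level w x1 - level w x|%N in r ^+ n * dipole (iter n (predecessor w) x)
  else 0.

Lemma wave_above r x : level w x1 < level w x -> wave r x = 0.
Proof. by rewrite /wave ltNge => /negPf ->. Qed.

Lemma wave_at r x : level w x = level w x1 -> wave r x = dipole x.
Proof. by rewrite /wave => ->; rewrite lexx subrr /= mul1r. Qed.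

Lemma wave_rec r x : wave r x = dipole x + r * wave r (predecessor w x).
Proof.
have [lx|lx|lx] := ltgtP (level w x) (level w x1).
- have -> : dipole x = 0.
    by apply: contraTeq lx => /dipole_neq0 ->; rewrite ltxx.
  rewrite add0r /wave (ltW lx) level_predecessor //.
  have -> : level w x + 1 <= level w x1 by lia.
  have -> : `|level w x1 - level w x|%N = `|level w x1 - (level w x + 1)%R|%N.+1 by lia.
  by rewrite iterSr exprS mulrA.
- rewrite !wave_above // ?level_predecessor //; last by lia.
  rewrite mulr0 addr0; apply/esym.
  by apply: contraTeq lx => /dipole_neq0 ->; rewrite ltxx.
- rewrite wave_at // wave_above ?level_predecessor //; last by lia.
  by rewrite mulr0 addr0.
Qed.

Lemma wave_norm r x : 0 <= r <= 1 -> `|wave r x| <= 1.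
Proof.
move=> /andP[r0 r1]; rewrite /wave; case: ifP => _; last by rewrite normr0.
by rewrite normrM mulr_ile1 ?dipole_norm // normrX ger0_norm // exprn_ile1.
Qed.

Lemma dipole_wave r x : dipole x * wave r (predecessor w x) = 0.
Proof.
have [->|/dipole_neq0 lx] := eqVneq (dipole x) 0; first by rewrite mul0r.
by rewrite wave_above ?mulr0 // level_predecessor // lx; lia.
Qed.

(** On the copy of [l^2(nat)] generated by the dipole, the Laplacian is
    [1 - (S + S^* ) / 2] with [S] the unilateral shift, so a geometric sequence of
    ratio [r = e^{-t}] solves the resolvent equation at [- s = 1 - cosh t]. *)
Lemma wave_resolvent r x : r != 0 ->
  wave r x - (2^-1 * wave r (predecessor w x) +
     (2 * q%:R)^-1 * \sum_(y <- successors w x) wave r y) +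
  (1 - r) ^+ 2 / (2 * r) * wave r x = (2 * r)^-1 * dipole x.
Proof.
move=> r0.
have -> : \sum_(y <- successors w x) wave r y = q%:R * (r * wave r x).
  under eq_bigr do rewrite wave_rec.
  rewrite big_split /= sum_dipole_successors add0r big_seq.
  under eq_bigr => y do rewrite mem_successors // => /eqP ->.
  by rewrite -big_seq big_const_seq count_predT size_successors // iter_addr_0 mulr_natl.
have -> : dipole x = wave r x - r * wave r (predecessor w x).
  by rewrite [wave r x]wave_rec addrK.
by field; rewrite r0 gt_eqF.
Qed.

Lemma mass_dipole : mass w (fun x => dipole x ^+ 2) = (2 * mu w R x1)%:E.
Proof.
rewrite /mass (esumID [set x1; x2]) // => [|x _]; last first.
  by rewrite lee_fin mulr_ge0 ?sqr_ge0 ?ltW.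
rewrite setTI [X in (_ + X)%E]esum1 ?adde0 => [|x /= [_ /not_orP[/eqP n1 /eqP n2]]]; last first.
  by rewrite dipole_out // expr0n mul0r.
rewrite esum_fset //; last by move=> x _; rewrite lee_fin mulr_ge0 ?sqr_ge0 ?ltW.
rewrite fsbigU0 //=; last by move=> x /= [-> e]; move: siblings_neq; rewrite e eqxx.
rewrite !fsbig_set1 dipole_x1 dipole_x2 sqrrN expr1n !mul1r mu_siblings.
by rewrite -EFinD mulr_natl mulr2n.
Qed.

(** By [wave_rec] and the isometry, going one generation further down adds the
    energy of the dipole to [r ^ 2] times the previous energy. *)
Lemma mass_wave r : 0 <= r < 1 -> (mass w (fun x => wave r x ^+ 2)%R < +oo)%E.
Proof.
move=> /andP[r0 r1].
(* the squared wave, cut [N] generations below the dipole *)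
pose F N x : R := if level w x1 - N%:Z < level w x then wave r x ^+ 2 else 0.
have F0 N x : 0 <= F N x by rewrite /F; case: ifP => // _; exact: sqr_ge0.
have FS N x : F N.+1 x = dipole x ^+ 2 + r ^+ 2 * F N (predecessor w x).
  rewrite /F level_predecessor //.
  have -> : (level w x1 - N.+1%:Z < level w x) = (level w x1 - N%:Z < level w x + 1).
    by lia.
  case: ifP => lx.
    rewrite [in LHS]wave_rec sqrrD exprMn mulrCA dipole_wave mulr0 mul0rn addr0 //.
  have [->|/dipole_neq0 e] := eqVneq (dipole x) 0; first by rewrite expr0n mulr0 addr0.
  by move: lx; rewrite e; lia.
pose G := 2 * mu w R x1.
have r2 : 0 < 1 - r ^+ 2 by rewrite subr_gt0 expr_lt1.
have FG N : (mass w (F N) <= (G / (1 - r ^+ 2))%:E)%E.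
  elim: N => [|N IH].
    rewrite /mass esum1 ?lee_fin ?divr_ge0 ?mulr_ge0 ?ltW // => x _.
    by rewrite /F subr0; case: ifP => lx; rewrite ?wave_above // ?expr0n mul0r.
  rewrite (eq_mass w (FS N)) massD // => [|x|x]; last 2 first.
    by rewrite sqr_ge0.
    by rewrite mulr_ge0 ?sqr_ge0.
  rewrite mass_dipole -/G.
  apply: (@le_trans _ _ (G%:E + (r ^+ 2)%:E * mass w (F N))%E).
    rewrite leeD2l // -[in leRHS](mass_predecessor hq hw) //.
    by apply: mass_scale_le; rewrite ?sqr_ge0 //= => x; exact: F0.
  apply: (@le_trans _ _ (G%:E + (r ^+ 2)%:E * (G / (1 - r ^+ 2))%:E)%E).
    by rewrite leeD2l // lee_wpmul2l // lee_fin sqr_ge0.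
  rewrite -EFinM -EFinD lee_fin le_eqVlt; apply/orP; left; apply/eqP.
  by field; rewrite gt_eqF.
apply: (@le_lt_trans _ _ (G / (1 - r ^+ 2))%:E); last exact: ltry.
rewrite ge_ereal_sup //= => _ [X [finX XI]] <-.
have [N HN] : exists N, forall x, X x -> level w x1 - N%:Z < level w x.
  have [s Xs] := (finite_seqP X).1 finX.
  exists (\max_(x <- s) `|level w x1 - level w x|%N).+1 => x Xx.
  have xs : x \in s by move: Xx; rewrite Xs.
  have := @leq_bigmax_seq _ s xpredT (fun x => `|level w x1 - level w x|%N) x xs isT.
  by set M := (\max_(_ <- _) _)%N; lia.
apply: le_trans (FG N); apply: esum_ge; exists X; first by split.
rewrite le_eqVlt; apply/orP; left; apply/eqP; apply: eq_fsbigr => x.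
by rewrite inE => /HN lx; rewrite /F lx.
Qed.

End Siblings.

(** * Dipoles in [L^2] and in [BMO] *)

Section SiblingsNorms.
Context (R : realType) (q : nat) (hq : (2 <= q)%N) (T : homTree q).
Context (w : nat -> T) (hw : geodesic_ray w).
Context (x1 x2 : T) (sib : siblings w x1 x2).
Implicit Types (x y : T) (f h : T -> R[i]) (r : R).

Let mu0 x : 0 < mu w R x := mu_gt0 R hq w x.

Definition cdipole x : R[i] := (dipole R x1 x2 x)%:C.

(** The dipole lives on two points, so that polarisation reduces to the values of
    [h] there; this stands for the inner product with the dipole. *)
Lemma energy_dipole_comb (a : R) h :
  energy w (fun x => a%:C * cdipole x + h x) = (energy w h +
    (mu w R x1 * (2 * a ^+ 2 + 2 * a * (complex.Re (h x1) - complex.Re (h x2))))%:E)%E.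
Proof.
have term0 f x : (0 <= (Normc.normc (f x) ^+ 2 * mu w R x)%:E)%E.
  by rewrite lee_fin mulr_ge0 ?sqr_ge0 ?ltW.
have splitE f : energy w f = ((Normc.normc (f x1) ^+ 2 * mu w R x1 +
    Normc.normc (f x2) ^+ 2 * mu w R x2)%:E +
    \esum_(x in ~` [set x1; x2]) (Normc.normc (f x) ^+ 2 * mu w R x)%:E)%E.
  rewrite /energy /mass (esumID [set x1; x2]) => [|x _]; last exact: term0.
  rewrite !setTI esum_fset //.
  by rewrite fsbigU0 ?fsbig_set1 // => x /= [-> e]; move: (siblings_neq sib); rewrite e eqxx.
rewrite !splitE addeAC; congr (_ + _)%E; last first.
  apply: eq_esum => x /= /not_orP[/eqP n1 /eqP n2].
  by rewrite /cdipole dipole_out // rmorph0 mulr0 add0r.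
rewrite (mu_siblings R hw sib) /cdipole (dipole_x1 R sib) (dipole_x2 R sib).
rewrite -!EFinD; congr _%:E; rewrite !normc2E.
case: (h x1) (h x2) => [a1 b1] [a2 b2] /=; ring.
Qed.

Lemma complex_wave_resolvent r (s : R) x : r != 0 -> s = (1 - r) ^+ 2 / (2 * r) ->
  s%:C * (wave w x1 x2 r x)%:C +
    flow_laplacian w (fun x => (wave w x1 x2 r x)%:C) x =
  ((2 * r)^-1)%:C * cdipole x.
Proof.
move=> r0 sE; have := wave_resolvent hq hw sib x r0; rewrite -sE.
move=> /(congr1 (real_complex R)).
rewrite !(rmorphD, rmorphN, rmorphM, rmorph_sum) /= => E.
by rewrite addrC flow_laplacianE // /cdipole /dipole rmorphB -E.
Qed.

Lemma energy_cdipole : energy w cdipole = (2 * mu w R x1)%:E.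
Proof.
rewrite -(mass_dipole R hq hw sib); apply: eq_mass => x.
exact: normc2R.
Qed.

(** The set of successors of a vertex is an admissible trapezoid, so values at
    siblings cannot differ much for a function in [BMO]. *)
Lemma sibling_oscillation : exists2 c : R, 0 < c &
  forall f, ((c * Normc.normc (f x1 - f x2))%:E <= normBMO w f)%E.
Proof.
pose s := successors w (predecessor w x1).
have s1 : x1 \in s by rewrite mem_successors.
have s2 : x2 \in s by rewrite mem_successors // (siblings_predecessor sib).
pose F := trapezoid w 1 2 (predecessor w x1).
have FE : F = [set` s] by apply: successors_trapezoid.
have split2 (u : T -> R) : (forall x, 0 <= u x) -> u x1 + u x2 <= \sum_(x \in F) u x.
  move=> u0; rewrite FE -fsbig_seq ?successors_uniq //.
  have s2' : x2 \in rem x1 s by rewrite mem_rem_uniq ?successors_uniq // inE eq_sym (siblings_neq sib).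
  by rewrite (big_rem x1) //= lerD2l (big_rem x2) //= lerDl sumr_ge0.
have M0 : 0 < muset w R F.
  apply: lt_le_trans (split2 (mu w R) _); first by rewrite addr_gt0.
  by move=> x; rewrite ltW.
exists (mu w R x1 / muset w R F); first by rewrite divr_gt0.
move=> f; apply: (@le_trans _ _ ((muset w R F)^-1 *
    \sum_(x \in F) Normc.normc (f x - average w F f) * mu w R x)%:E); last first.
  apply: ereal_sup_ubound; exists F => //; right.
  by exists (predecessor w x1), 1%N, 2%N.
rewrite lee_fin [_ / _]mulrC -mulrA ler_pM2l ?invr_gt0 //.
set a := average w F f.
apply: le_trans (split2 (fun x => Normc.normc (f x - a) * mu w R x) _); last first.
  by move=> x; rewrite mulr_ge0 ?normc_ge0 ?ltW.
rewrite (mu_siblings R hw sib) -mulrDl mulrC ler_pM2r //.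
rewrite -[Normc.normc (f x2 - a)]normcN.
apply: le_trans (le_normcD _ _).
by rewrite opprB addrA subrK.
Qed.

End SiblingsNorms.

(** * A singularity at the bottom of the spectrum *)

Section StieltjesSingularity.
Context (R : realType) (d : measure_display) (Y : measurableType d).
Context (nu : {measure set Y -> \bar R}).
Implicit Types (f t U V : Y -> R).

Lemma measurable_inv_ge0 f : (forall y, 0 <= f y) ->
  measurable_fun [set: Y] f -> measurable_fun [set: Y] (fun y => (f y)^-1).
Proof.
move=> f0 mf; have -> : (fun y => (f y)^-1) = (@powR R ^~ (-1)) \o f.
  by apply/funext => y /=; rewrite powR_inv1.
exact: (measurableT_comp (measurable_powR _) mf).
Qed.

Lemma measurable_sqrt f :
  measurable_fun [set: Y] f -> measurable_fun [set: Y] (fun y => Num.sqrt (f y)).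
Proof.
move=> mf; have -> : (fun y => Num.sqrt (f y)) =
    (@powR R ^~ 2^-1) \o (fun y => Num.max (f y) 0).
  apply/funext => y /=; rewrite powR12_sqrt ?le_max ?lexx ?orbT //.
  by case: leP => // /ler0_sqrtr ->; rewrite sqrtr0.
apply: (measurableT_comp (measurable_powR _)).
by apply: measurable_maxr => //; exact: measurable_cst.
Qed.

Lemma measurable_inv_sqrt f :
  measurable_fun [set: Y] f -> measurable_fun [set: Y] (fun y => inv_sqrt (f y)).
Proof.
by move=> mf; apply: measurable_inv_ge0 => [y|]; [exact: sqrtr_ge0|exact: measurable_sqrt].
Qed.

(** Ratios of geometric waves that tend to [1], with the opposites [wave_shift] of
    the corresponding spectral parameters. *)
Definition wave_ratio (n : nat) : R := n.+1%:R / n.+2%:R.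

Definition wave_shift (n : nat) : R := (1 - wave_ratio n) ^+ 2 / (2 * wave_ratio n).

Lemma wave_shiftE n : wave_shift n = (2 * n.+1%:R * n.+2%:R)^-1.
Proof.
rewrite /wave_shift /wave_ratio -[n.+2%:R]natr1.
by field; rewrite ?nat1r ?natr1 !pnatr_eq0.
Qed.

Lemma wave_shift_gt0 n : 0 < wave_shift n.
Proof. by rewrite wave_shiftE invr_gt0 !mulr_gt0 ?ltr0n. Qed.

Lemma wave_shift_le m n : (m <= n)%N -> wave_shift n <= wave_shift m.
Proof.
move=> mn; rewrite !wave_shiftE lef_pV2 ?posrE ?mulr_gt0 ?ltr0n //.
by rewrite ler_pM ?mulr_ge0 ?ler0n // ?ler_pM2l ?ltr0n // ler_nat ltnS.
Qed.

Lemma cvg_wave_shift : wave_shift n @[n --> \oo] --> (0 : R).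
Proof.
apply: (@squeeze_cvgr _ _ _ _ (cst 0) harmonic); last 2 first.
- exact: cvg_cst.
- exact: cvg_harmonic.
near=> n; rewrite ltW ?wave_shift_gt0 //= wave_shiftE lef_pV2 ?posrE ?mulr_gt0 ?ltr0n //.
rewrite -!natrM ler_nat; lia.
Unshelve. all: by end_near. Qed.

Lemma cvg_wave_ratio : wave_ratio n @[n --> \oo] --> (1 : R).
Proof.
rewrite (_ : wave_ratio = fun n => 1 - harmonic n.+1); last first.
  apply/funext => n /=; rewrite /wave_ratio -[n.+2%:R]natr1.
  by field; rewrite ?nat1r ?natr1 pnatr_eq0.
rewrite -[X in _ --> X]subr0; apply: cvgB; first exact: cvg_cst.
by rewrite (cvg_shiftS (@harmonic R : nat -> R)); exact: cvg_harmonic.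
Qed.

Context (t : Y -> R).
Context (mt : measurable_fun [set: Y] t) (t0 : forall y, 0 <= t y).

Lemma cvg_inv_wave_shift y : 0 < t y ->
  (t y + wave_shift n)^-1 @[n --> \oo] --> (t y)^-1.
Proof.
move=> ty; apply: cvgV; first by rewrite gt_eqF.
by rewrite -[X in _ --> X]addr0; apply: cvgD; [exact: cvg_cst|exact: cvg_wave_shift].
Qed.

Lemma measurable_inv_wave_shift n : measurable_fun [set: Y] (fun y => (t y + wave_shift n)^-1).
Proof.
apply: measurable_inv_ge0; first by move=> y; rewrite addr_ge0 // ltW ?wave_shift_gt0.
by apply: measurable_funD => //; exact: measurable_cst.
Qed.

Lemma cvg_resolvent U : measurable_fun [set: Y] U -> (forall y, 0 <= U y) ->
  (forall y, U y != 0 -> 0 < t y) ->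
  (\int[nu]_y (U y * (t y + wave_shift n)^-1)%:E)%E @[n --> \oo] -->
  (\int[nu]_y (U y * (t y)^-1)%:E)%E.
Proof.
move=> mU U0 Ut; pose F n y := (U y * (t y + wave_shift n)^-1)%:E.
have ts n y : 0 < t y + wave_shift n by rewrite ltr_wpDl ?wave_shift_gt0.
have mF n : measurable_fun [set: Y] (F n).
  by apply/measurable_EFinP/measurable_funM => //; exact: measurable_inv_wave_shift.
have F0 n y : [set: Y] y -> (0 <= F n y)%E.
  by move=> _; rewrite lee_fin mulr_ge0 // invr_ge0 ltW.
have ndF y : [set: Y] y -> {homo F^~ y : n m / (n <= m)%N >-> (n <= m)%E}.
  move=> _ n m nm; rewrite lee_fin ler_wpM2l // lef_pV2 ?posrE //.
  by rewrite lerD2l wave_shift_le.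
have := @cvg_monotone_convergence _ _ _ nu _ measurableT F mF F0 ndF.
rewrite (_ : (fun y => limn (F^~ y)) = fun y => (U y * (t y)^-1)%:E) //.
apply/funext => y; apply/cvg_lim => //.
have [Uy|/Ut ty] := eqVneq (U y) 0.
  rewrite /F Uy mul0r; under eq_fun do rewrite mul0r.
  exact: cvg_cst.
apply: cvg_EFin; first by near=> n.
by apply: cvgM; [exact: cvg_cst|exact: cvg_inv_wave_shift].
Unshelve. all: by end_near. Qed.

Context (V : Y -> R) (G : R).
Context (mV : measurable_fun [set: Y] V) (V0 : forall y, 0 <= V y).
Context (Vt : forall y, V y != 0 -> 0 < t y).
Context (resolvent : forall n,
  (\int[nu]_y (V y * (t y + wave_shift n)^-1)%:E = (wave_ratio n * G)%:E)%E).

(** The resolvent integrals increase to the one at the spectral parameter [0]. *)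
Lemma integral_resolvent0 : (\int[nu]_y (V y * (t y)^-1)%:E = G%:E)%E.
Proof.
have lim := cvg_resolvent mV V0 Vt.
suff : (\int[nu]_y (V y * (t y + wave_shift n)^-1)%:E)%E @[n --> \oo] --> G%:E.
  by move=> lim'; exact: (cvg_unique _ lim lim').
rewrite (funext resolvent).
apply: cvg_EFin; first by near=> n.
rewrite -[X in _ --> X]mul1r.
by apply: cvgM; [exact: cvg_wave_ratio|exact: cvg_cst].
Unshelve. all: by end_near. Qed.

(** The hypothesis [resolvent] says that the Stieltjes transform of the law of [t]
    under [V * nu] behaves like [G * (1 - sqrt (2 * s))] when [s] tends to [0].
    If the integrals were bounded, [V * t^(-3/2)] would be integrable by monotone
    convergence. It dominates the difference quotients
    [V * (1 / t - 1 / (t + s)) / sqrt s], whose integrals would tend to [0]; but that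
    square root singularity keeps them away from [0]. *)
Lemma integral_inv_sqrt_unbounded : 0 < G ->
  ~ exists K : R, forall n,
    (\int[nu]_y (V y * inv_sqrt (t y) * (t y + wave_shift n)^-1)%:E <= K%:E)%E.
Proof.
move=> G0 [K HK].
pose U y := V y * inv_sqrt (t y).
have is0 y : 0 <= inv_sqrt (t y) by rewrite invr_ge0 sqrtr_ge0.
have mU : measurable_fun [set: Y] U.
  by apply: measurable_funM => //; exact: measurable_inv_sqrt.
have U0 y : 0 <= U y by rewrite mulr_ge0.
have Ut y : U y != 0 -> 0 < t y by rewrite mulf_eq0 negb_or => /andP[/Vt].
pose B y : R := U y * (t y)^-1.
have mB : measurable_fun [set: Y] B.
  by apply: measurable_funM => //; exact: measurable_inv_ge0.
have B0 y : 0 <= B y by rewrite mulr_ge0 ?invr_ge0.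
have iB : nu.-integrable [set: Y] (EFin \o B).
  apply/integrableP; split; first exact/measurable_EFinP.
  apply: (@le_lt_trans _ _ K%:E); last exact: ltry.
  under eq_integral do rewrite /= ger0_norm //.
  have lim := cvg_resolvent mU U0 Ut.
  have <- := cvg_lim (@ereal_hausdorff R) lim.
  by apply: lime_le; [apply/cvg_ex; eexists; exact: lim|apply: nearW].
(* [c n], of the order of [1 / sqrt (wave_shift n)], is the normalisation for
   which the difference quotients all have integral [2 * G] *)
pose c n : R := 2 * n.+2%:R.
pose D n y := V y * (t y)^-1 - V y * (t y + wave_shift n)^-1.
have mI : measurable_fun [set: Y] (fun y => V y * (t y)^-1).
  by apply: measurable_funM => //; exact: measurable_inv_ge0.
have mIs n : measurable_fun [set: Y] (fun y => V y * (t y + wave_shift n)^-1).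
  by apply: measurable_funM => //; exact: measurable_inv_wave_shift.
have mD n : measurable_fun [set: Y] (D n) by apply: measurable_funB.
have intD n : (\int[nu]_y (c n * D n y)%:E = (2 * G)%:E)%E.
  have I1 : nu.-integrable [set: Y] (EFin \o (fun y => V y * (t y)^-1)).
    apply/integrableP; split; first exact/measurable_EFinP.
    under eq_integral do rewrite /= ger0_norm ?mulr_ge0 ?invr_ge0 //.
    by rewrite integral_resolvent0 ltry.
  have I2 : nu.-integrable [set: Y] (EFin \o (fun y => V y * (t y + wave_shift n)^-1)).
    apply/integrableP; split; first exact/measurable_EFinP.
    under eq_integral => y _.
      rewrite /= ger0_norm; last first.
        by rewrite mulr_ge0 // invr_ge0 addr_ge0 // ltW ?wave_shift_gt0.
      over.
    by rewrite resolvent ltry.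
  under eq_integral do rewrite EFinM.
  rewrite integralZl //; last first.
    have := integrableB measurableT I1 I2.
    by apply: eq_integrable => // y _; rewrite /= -EFinB.
  under eq_integral do rewrite EFinB.
  rewrite integralB_EFin // integral_resolvent0 resolvent -EFinB -EFinM; congr _%:E.
  rewrite /c /wave_ratio -[n.+2%:R]natr1.
  by field; rewrite ?nat1r ?natr1 pnatr_eq0.
have DE n y : 0 < t y -> c n * D n y = V y * (n.+1%:R * t y * (t y + wave_shift n))^-1.
  move=> ty; have ts : 0 < t y + wave_shift n by rewrite addr_gt0 ?wave_shift_gt0.
  have -> : D n y = V y * (wave_shift n * (t y * (t y + wave_shift n))^-1).
    by rewrite /D -mulrBr; congr (_ * _); field; rewrite !gt_eqF.
  have -> : c n * (V y * (wave_shift n * (t y * (t y + wave_shift n))^-1)) =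
      V y * (c n * wave_shift n) / (t y * (t y + wave_shift n)).
    by field; rewrite !gt_eqF.
  have -> : c n * wave_shift n = n.+1%:R^-1.
    rewrite /c wave_shiftE; field.
    by rewrite -natrD nat1r !pnatr_eq0.
  by field; rewrite !gt_eqF //= ?nat1r ltr0n.
have D0 n y : V y = 0 -> c n * D n y = 0 by rewrite /D => ->; rewrite !mul0r subrr mulr0.
have Dge0 n y : 0 <= c n * D n y.
  have [/D0 ->//|/Vt ty] := eqVneq (V y) 0; rewrite DE //.
  by rewrite mulr_ge0 // invr_ge0 !mulr_ge0 ?addr_ge0 // ltW ?wave_shift_gt0.
(* arithmetic-geometric mean inequality for [t y + wave_shift n] *)
have DB n y : c n * D n y <= B y.
  have [Vy|Vy] := eqVneq (V y) 0; first by rewrite D0.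
  have ty := Vt Vy; rewrite DE // /B /U -[leRHS]mulrA ler_wpM2l //.
  rewrite /inv_sqrt -invfM lef_pV2 ?posrE; last 2 first.
  - by rewrite !mulr_gt0 ?ltr0n // addr_gt0 ?wave_shift_gt0.
  - by rewrite mulr_gt0 ?sqrtr_gt0.
  rewrite mulrC [n.+1%:R * t y]mulrC -mulrA ler_pM2l //.
  set k : R := n.+1%:R; have k0 : 0 < k by rewrite ltr0n.
  have k1 : 1 <= k by rewrite ler1n.
  set z : R := Num.sqrt (t y); have z0 : 0 < z by rewrite sqrtr_gt0.
  have -> : t y = z ^+ 2 by rewrite sqr_sqrtr.
  have : (2 * k) ^- 2 <= wave_shift n.
    rewrite wave_shiftE lef_pV2 ?posrE ?mulr_gt0 ?exprn_gt0 ?ltr0n ?mulr_gt0 //.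
    rewrite -[n.+2%:R]natr1 -/k; nra.
  move=> H; apply: (@le_trans _ _ (k * (z ^+ 2 + (2 * k) ^- 2))); last first.
    by rewrite ler_pM2l // lerD2l.
  have := sqr_ge0 (z - (2 * k)^-1); rewrite sqrrB exprVn.
  set e := (2 * k) ^- 2.
  have -> : z * (2 * k)^-1 *+ 2 = z / k by rewrite mulr2n; field; rewrite gt_eqF.
  move=> H1; have : z / k <= z ^+ 2 + e by rewrite -subr_ge0 addrAC.
  by rewrite ler_pdivrMr // mulrC.
have cvgD0 y : (c n * D n y)%:E @[n --> \oo] --> (0 : \bar R)%E.
  apply: cvg_EFin; first by near=> n.
  have [Vy|Vy] := eqVneq (V y) 0.
    by under eq_fun do rewrite /= D0 //; exact: cvg_cst.
  have ty := Vt Vy; under eq_fun do rewrite /= DE //.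
  apply: (@squeeze_cvgr _ _ _ _ (cst 0) (fun n => V y / t y ^+ 2 * harmonic n)).
  - near=> n; rewrite /= -(DE _ _ ty) Dge0 /= DE // -[leRHS]mulrA ler_wpM2l //.
    have ts : 0 < t y + wave_shift n by rewrite addr_gt0 ?wave_shift_gt0.
    rewrite /harmonic -invfM lef_pV2 ?posrE ?mulr_gt0 ?exprn_gt0 ?ltr0n //.
    rewrite mulrC expr2 -[leRHS]mulrA ler_pM2l ?ltr0n // ler_pM2l //.
    by rewrite lerDl ltW ?wave_shift_gt0.
  - exact: cvg_cst.
  - by rewrite -[X in _ --> X](mulr0 (V y / t y ^+ 2)); apply: cvgM;
      [exact: cvg_cst|exact: cvg_harmonic].
have mcD n : measurable_fun [set: Y] (fun y => (c n * D n y)%:E).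
  by apply/measurable_EFinP; apply: measurable_funM => //; exact: measurable_cst.
have absD : {ae nu, forall y n, [set: Y] y -> (`|(c n * D n y)%:E| <= (EFin \o B) y)%E}.
  by apply: aeW => y n _; rewrite lee_fin ger0_norm.
have limD : {ae nu, forall y, [set: Y] y -> (c n * D n y)%:E @[n --> \oo] --> (0 : \bar R)%E}.
  by apply: aeW => y _; exact: cvgD0.
have [_ _] := dominated_convergence measurableT mcD (measurable_cst _) limD iB absD.
rewrite integral0 => /= H.
have : (2 * G)%:E = 0%E :> \bar R.
  by apply: (cvg_unique _ _ H) => //; rewrite (funext intD); exact: cvg_cst.
by move=> [/eqP]; rewrite mulf_eq0 (gt_eqF G0) pnatr_eq0.
Unshelve. all: by end_near. Qed.

End StieltjesSingularity.

(** * Spectral representation *)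

Section SpectralMeasure.
Context (R : realType) (q : nat) (hq : (2 <= q)%N) (T : homTree q).
Context (w : nat -> T) (hw : geodesic_ray w).
Context (d : measure_display) (Y : measurableType d).
Context (nu : {measure set Y -> \bar R}) (m : Y -> R).
Context (U : (T -> R[i]) -> (Y -> R[i])).
Context (hU : diagonalizes w nu m U (flow_laplacian w (R := R))).
Implicit Types (f g h : T -> R[i]) (u : Y -> R[i]) (a phi : Y -> R).

Let mm : measurable_fun [set: Y] m. Proof. by case: hU. Qed.

Let Unorm f : inL2 w f -> inL2_of nu (U f) /\ normL2_of nu (U f) = normL2 w f.
Proof. by case: hU => _ [H _]; exact: H. Qed.

Let Ulin (z : R[i]) f g : inL2 w f -> inL2 w g ->
  {ae nu, forall y, U (fun x => z * f x + g x) y = z * U f y + U g y}.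
Proof. by case: hU => _ [_ [H _]]; exact: H. Qed.

Let Usurj u : inL2_of nu u -> exists2 f, inL2 w f & {ae nu, forall y, U f y = u y}.
Proof. by case: hU => _ [_ [_ [H _]]]; exact: H. Qed.

Let Ulap f : inL2 w f -> {ae nu, forall y, U (flow_laplacian w f) y = (m y)%:C * U f y}.
Proof. by case: hU => _ [_ [_ [_ H]]]; exact: H. Qed.

(** When [f] is the dipole this is the density of its spectral measure, transported
    to [Y]. *)
Definition density f y : R := Normc.normc (U f y) ^+ 2.

Lemma density_ge0 f y : 0 <= density f y.
Proof. exact: sqr_ge0. Qed.

Lemma measurable_normc2 u : inL2_of nu u ->
  measurable_fun [set: Y] (fun y => Normc.normc (u y) ^+ 2).
Proof.
move=> [mRe mIm _]; under eq_fun do rewrite normc2E.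
by apply: measurable_funD; exact: measurable_funX.
Qed.

Lemma measurable_density f : inL2 w f -> measurable_fun [set: Y] (density f).
Proof. by move=> /Unorm[fU _]; exact: measurable_normc2. Qed.

Lemma integral_density f : inL2 w f -> (\int[nu]_y (density f y)%:E = energy w f)%E.
Proof.
move=> fL; have [_] := Unorm fL; rewrite normL2E /normL2_of => e.
rewrite -[LHS]sqr_sqrte ?integral_ge0 // => [|y _]; last by rewrite lee_fin density_ge0.
by rewrite e sqr_sqrte // energy_ge0.
Qed.

Lemma integrable_density f : inL2 w f -> nu.-integrable [set: Y] (EFin \o density f).
Proof.
move=> fL; apply/integrableP; split; first exact/measurable_EFinP/measurable_density.
under eq_integral do rewrite /= ger0_norm ?density_ge0 //.
by rewrite integral_density // -/(inL2 w f); apply/inL2E.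
Qed.

Lemma inL2_multiplier a f : inL2 w f -> measurable_fun [set: Y] a ->
  (\int[nu]_y (a y ^+ 2 * density f y)%:E < +oo)%E ->
  exists2 h, inL2 w h & {ae nu, forall y, U h y = (a y)%:C * U f y}.
Proof.
move=> fL ma fin; apply: Usurj; have [[mRe mIm _] _] := Unorm fL; split.
- rewrite (_ : (fun y => _) = fun y => a y * complex.Re (U f y)).
    exact: measurable_funM.
  by apply/funext => y; case: (U f y) => ? ? /=; rewrite mul0r subr0.
- rewrite (_ : (fun y => _) = fun y => a y * complex.Im (U f y)).
    exact: measurable_funM.
  by apply/funext => y; case: (U f y) => ? ? /=; rewrite mul0r addr0.
- rewrite /normL2_of sqrte_lty; last first.
    by apply: integral_ge0 => y _; rewrite lee_fin sqr_ge0.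
  by under eq_integral do rewrite normc2M normc2R.
Qed.

Lemma energy_multiplier a f h : inL2 w f -> inL2 w h ->
  measurable_fun [set: Y] a ->
  {ae nu, forall y, U h y = (a y)%:C * U f y} ->
  (energy w h = \int[nu]_y (a y ^+ 2 * density f y)%:E)%E.
Proof.
move=> fL hL ma e; rewrite -integral_density //.
apply: ge0_ae_eq_integral => //.
- exact/measurable_EFinP/measurable_density.
- apply/measurable_EFinP/measurable_funM; first exact: measurable_funX.
  exact: measurable_density.
- by move=> y _; rewrite lee_fin density_ge0.
- by move=> y _; rewrite lee_fin mulr_ge0 ?sqr_ge0 ?density_ge0.
- by apply: filterS e => y e _; rewrite /density e normc2M normc2R.
Qed.

(** The spectrum is nonnegative: the part [f1] of [f] on which [m < 0] would be
    expanded by the contraction [flow_average = 1 - L]. *)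
Lemma negative_spectrum f : inL2 w f -> {ae nu, forall y, m y < 0 -> U f y = 0}.
Proof.
move=> fL; pose a y : R := if m y < 0 then 1 else 0.
have ma : measurable_fun [set: Y] a.
  apply: measurable_fun_ifT; [|exact: measurable_cst|exact: measurable_cst].
  by apply: measurable_fun_ltr => //; exact: measurable_cst.
have mdf := measurable_density fL.
have aM y : a y ^+ 2 = a y by rewrite /a; case: ifP => _; rewrite ?expr1n ?expr0n.
have a0 y : 0 <= a y by rewrite /a; case: ifP.
have mv : measurable_fun [set: Y] (fun y => a y * density f y).
  exact: measurable_funM.
have v0 y : 0 <= a y * density f y by rewrite mulr_ge0 // density_ge0.
have vfin : (\int[nu]_y (a y * density f y)%:E < +oo)%E.
  apply: le_lt_trans ((inL2E hq w f).1 fL); rewrite -integral_density //.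
  apply: ge0_le_integral => //; try exact/measurable_EFinP.
    by move=> y _; rewrite lee_fin.
  move=> y _; rewrite lee_fin /a; case: ifP => _; rewrite ?mul1r //.
  by rewrite mul0r density_ge0.
have [|f1 f1L e1] := inL2_multiplier fL ma.
  by under eq_integral do rewrite aM.
have e2 : {ae nu, forall y, U (flow_average w f1) y = ((1 - m y) * a y)%:C * U f y}.
  have -> : flow_average w f1 = fun x => -1 * flow_laplacian w f1 x + f1 x.
    by apply/funext => x; rewrite flow_laplacianE // mulN1r opprB subrK.
  have := Ulin (-1) (inL2_flow_laplacian hq hw f1L) f1L.
  apply: filterS3 (Ulap f1L) e1 => y el e1 ->; rewrite el e1.
  by rewrite rmorphM rmorphB rmorph1; ring.
have := energy_flow_average hq hw f1.
rewrite (energy_multiplier fL f1L ma e1).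
rewrite (energy_multiplier fL (inL2_flow_average hq hw f1L) _ e2); last first.
  by apply: measurable_funM => //; apply: measurable_funB => //; exact: measurable_cst.
pose k y := ((1 - m y) ^+ 2 - 1) * (a y * density f y).
have k0 y : 0 <= k y.
  rewrite /k /a; case: ifP => my; last by rewrite mul0r mulr0.
  rewrite mul1r mulr_ge0 ?density_ge0 //; nra.
have mk : measurable_fun [set: Y] k.
  apply: measurable_funM => //; apply: measurable_funB; last exact: measurable_cst.
  by apply: measurable_funX; apply: measurable_funB => //; exact: measurable_cst.
under eq_integral => y _.
  have -> : ((1 - m y) * a y) ^+ 2 * density f y = a y * density f y + k y.
    by rewrite exprMn aM /k; ring.
  rewrite EFinD; over.
rewrite ge0_integralD //; try exact/measurable_EFinP; last 2 first.
- by move=> y _; rewrite lee_fin.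
- by move=> y _; rewrite lee_fin.
under [X in (_ <= X)%E]eq_integral do rewrite aM.
rewrite -[leRHS]adde0 leeD2lE; last first.
  by rewrite ge0_fin_numE // integral_ge0 // => y _; rewrite lee_fin.
move=> kle; have kI : (\int[nu]_y `|(k y)%:E| = 0)%E.
  under eq_integral do rewrite /= ger0_norm //.
  by apply/eqP; rewrite eq_le kle integral_ge0 // => y _; rewrite lee_fin.
have /(ae_eq_integral_abs nu measurableT) := kI.
move=> /(_ ((measurable_EFinP _ _).2 mk)); apply: filterS => y /(_ I) [ky] my.
move: ky; rewrite /k /a my mul1r => /eqP; rewrite mulf_eq0 gt_eqF; last by nra.
by rewrite orFb sqrf_eq0 => /eqP /Normc.eq0_normc.
Qed.

End SpectralMeasure.

(** * The Riesz transform of the waves *)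

Section RieszSiblings.
Context (R : realType) (q : nat) (hq : (2 <= q)%N) (T : homTree q).
Context (w : nat -> T) (hw : geodesic_ray w).
Context (d : measure_display) (Y : measurableType d).
Context (nu : {measure set Y -> \bar R}) (m : Y -> R).
Context (U : (T -> R[i]) -> (Y -> R[i])).
Context (hU : diagonalizes w nu m U (flow_laplacian w (R := R))).
Context (x1 x2 : T) (sib : siblings w x1 x2).
Implicit Types (f h : T -> R[i]) (phi : Y -> R).

Let mm : measurable_fun [set: Y] m. Proof. by case: hU. Qed.
Let mu1_gt0 : 0 < mu w R x1 := mu_gt0 R hq w x1.
Let g : T -> R[i] := cdipole R x1 x2.

Let gL : inL2 w g.
Proof. by apply/inL2E => //; rewrite energy_cdipole // ltry. Qed.

Let W : Y -> R := density U g.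
Let W0 y : 0 <= W y. Proof. exact: density_ge0. Qed.
Let mW : measurable_fun [set: Y] W := measurable_density hU gL.

(** Polarisation: the inner product of [h] with the dipole, computed on both
    sides of the unitary map. *)
Lemma spectral_pairing h phi : inL2 w h -> measurable_fun [set: Y] phi ->
  {ae nu, forall y, U h y = (phi y)%:C * U g y} ->
  (\int[nu]_y (phi y * W y)%:E =
    (mu w R x1 * (complex.Re (h x1) - complex.Re (h x2)))%:E)%E.
Proof.
move=> hL mphi e.
have ghL : inL2 w (fun x => 1%:C * g x + h x) by apply: inL2_comb.
have e1 : {ae nu, forall y, U (fun x => 1%:C * g x + h x) y = (1 + phi y)%:C * U g y}.
  have [_ [_ [Ulin _]]] := hU.
  apply: filterS2 e (Ulin 1%:C _ _ gL hL) => y e ->.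
  by rewrite e rmorphD mulrDl.
have m1 : measurable_fun [set: Y] (fun y => 1 + phi y).
  by apply: measurable_funD => //; exact: measurable_cst.
have := energy_multiplier hq hU gL ghL m1 e1.
rewrite energy_dipole_comb // -/g (energy_multiplier hq hU gL hL mphi e) -/W.
have mP : measurable_fun [set: Y] (fun y => phi y ^+ 2 * W y).
  by apply: measurable_funM => //; exact: measurable_funX.
have mX : measurable_fun [set: Y] (fun y => phi y * W y) by exact: measurable_funM.
have iW : nu.-integrable [set: Y] (EFin \o W) := integrable_density hq hU gL.
have P0 y : 0 <= phi y ^+ 2 * W y by rewrite mulr_ge0 // sqr_ge0.
have iP : nu.-integrable [set: Y] (EFin \o (fun y => phi y ^+ 2 * W y)).
  apply/integrableP; split; first exact/measurable_EFinP.
  under eq_integral do rewrite /= ger0_norm //.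
  by rewrite -(energy_multiplier hq hU gL hL mphi e); apply/(inL2E hq).
have iX : nu.-integrable [set: Y] (EFin \o (fun y => phi y * W y)).
  apply: (@le_integrable _ _ _ _ _ measurableT _
    (fun y => (phi y ^+ 2 * W y)%:E + (W y)%:E)%E); first exact/measurable_EFinP.
  - move=> y _; rewrite -EFinD !lee_fin /= [leRHS]ger0_norm; last first.
      exact: addr_ge0.
    rewrite normrM (ger0_norm (W0 y)) -[X in _ + X]mul1r -mulrDl ler_wpM2r //.
    have := sqr_ge0 (`|phi y| - 1); rewrite -[phi y ^+ 2]real_normK ?num_real //.
    have := normr_ge0 (phi y); nra.
  - exact: integrableD.
have -> : (\int[nu]_y ((1 + phi y) ^+ 2 * W y)%:E =
    \int[nu]_y (phi y ^+ 2 * W y)%:E + 2%:E * \int[nu]_y (phi y * W y)%:E +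
    \int[nu]_y (W y)%:E)%E.
  under eq_integral => y _.
    have -> : (1 + phi y) ^+ 2 * W y = phi y ^+ 2 * W y + 2 * (phi y * W y) + W y.
      by ring.
    rewrite !EFinD [(2 * _)%:E]EFinM; over.
  rewrite integralD //; last by apply: integrableD => //; exact: (integrableZl measurableT 2 iX).
  rewrite integralD //; last exact: (integrableZl measurableT 2 iX).
  by rewrite integralZl.
rewrite (integral_density hq hU gL) energy_cdipole //.
have := integrable_fin_num measurableT iP.
have := integrable_fin_num measurableT iX => /=.
case: (\int[nu]_y (phi y * W y)%:E)%E => [X| |] // _.
case: (\int[nu]_y (phi y ^+ 2 * W y)%:E)%E => [P| |] // _.
rewrite -EFinM -!EFinD => -[H]; congr _%:E; move: H; rewrite expr1n.
set B := complex.Re _ - complex.Re _; lra.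
Qed.

Let rwave n : T -> R[i] := fun x => (wave w x1 x2 (wave_ratio R n) x)%:C.

Let ratio_bounds n : 0 < wave_ratio R n < 1.
Proof.
rewrite /wave_ratio divr_gt0 ?ltr0n //= ltr_pdivrMr ?ltr0n // mul1r ltr_nat //.
Qed.

Let rwaveL n : inL2 w (rwave n).
Proof.
have /andP[r0 r1] := ratio_bounds n.
apply/(inL2E hq); have := mass_wave hq hw sib (r := wave_ratio R n).
rewrite (ltW r0) r1 => /(_ isT); apply: le_lt_trans; rewrite le_eqVlt; apply/orP.
by left; apply/eqP/eq_mass => x; exact: normc2R.
Qed.

Let coef n y : R := (2 * wave_ratio R n)^-1 * (`|m y| + wave_shift R n)^-1.

Let coef_ge0 n y : 0 <= coef n y.
Proof.
have /andP[r0 _] := ratio_bounds n; have s0 := wave_shift_gt0 R n.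
apply: mulr_ge0; rewrite invr_ge0; first by rewrite mulr_ge0 // ltW.
by rewrite addr_ge0 // ltW.
Qed.

Let mabs : measurable_fun [set: Y] (fun y => `|m y|).
Proof. exact: (measurableT_comp (@normr_measurable R [set: R]) mm). Qed.

Let mcoef n : measurable_fun [set: Y] (coef n).
Proof.
apply: measurable_funM; first exact: measurable_cst.
exact: measurable_inv_wave_shift.
Qed.

(** The resolvent equation [(m + s) U f = U g / (2 r)], divided by [m + s]. Where
    [m] is negative both sides vanish, which allows the absolute value. *)
Lemma spectral_wave n :
  {ae nu, forall y, U (rwave n) y = (coef n y)%:C * U g y}.
Proof.
have [_ [_ [Ulin [_ Ulap]]]] := hU.
have /andP[r0 r1] := ratio_bounds n; set r := wave_ratio R n in r0 r1 *.
have s0 := wave_shift_gt0 R n; set s := wave_shift R n in s0 *.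
have eqn : (fun x => s%:C * rwave n x + flow_laplacian w (rwave n) x) =
    fun x => ((2 * r)^-1 - 1)%:C * g x + g x.
  apply/funext => x; rewrite /rwave (complex_wave_resolvent hq hw sib (r := r)) //.
    by rewrite rmorphB rmorph1 mulrBl mul1r subrK.
  by rewrite gt_eqF.
have L1 := Ulin s%:C _ _ (rwaveL n) (inL2_flow_laplacian hq hw (rwaveL n)).
have L2 := Ulin ((2 * r)^-1 - 1)%:C _ _ gL gL.
have N1 := negative_spectrum hq hw hU (rwaveL n).
have N2 := negative_spectrum hq hw hU gL.
have L3 := Ulap _ (rwaveL n).
rewrite eqn in L1.
near=> y.
have l1 : U (fun x => ((2 * r)^-1 - 1)%:C * g x + g x) y =
  s%:C * U (rwave n) y + U (flow_laplacian w (rwave n)) y by near: y.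
have l2 : U (fun x => ((2 * r)^-1 - 1)%:C * g x + g x) y =
  ((2 * r)^-1 - 1)%:C * U g y + U g y by near: y.
have l3 : U (flow_laplacian w (rwave n)) y = (m y)%:C * U (rwave n) y by near: y.
have n1 : m y < 0 -> U (rwave n) y = 0 by near: y.
have n2 : m y < 0 -> U g y = 0 by near: y.
have [m0|m0] := ltP (m y) 0; first by rewrite n1 // n2 // mulr0.
rewrite /coef ger0_norm // -/r -/s.
have ms : (m y + s)%:C != 0 :> R[i].
  by rewrite fmorph_eq0 gt_eqF // ltr_wpDl.
apply: (mulfI ms).
transitivity (s%:C * U (rwave n) y + (m y)%:C * U (rwave n) y).
  by rewrite rmorphD mulrDl addrC.
rewrite -l3 -l1 l2 [RHS]mulrA -[X in _ = X * _](rmorphM (real_complex R)).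
have -> : (m y + s) * ((2 * r)^-1 / (m y + s)) = (2 * r)^-1.
  by rewrite mulrCA mulfV ?mulr1 // gt_eqF // ltr_wpDl.
by rewrite rmorphB rmorph1 mulrBl mul1r subrK.
Unshelve. all: by end_near. Qed.

Lemma wave_pairing n : (\int[nu]_y (W y * (`|m y| + wave_shift R n)^-1)%:E =
  (wave_ratio R n * (4 * mu w R x1))%:E)%E.
Proof.
have /andP[r0 r1] := ratio_bounds n.
have := spectral_pairing (rwaveL n) (mcoef n) (spectral_wave n).
have w1 : wave w x1 x2 (wave_ratio R n) x1 = 1.
  by rewrite wave_at // (dipole_x1 R sib).
have w2 : wave w x1 x2 (wave_ratio R n) x2 = -1.
  by rewrite wave_at ?(dipole_x2 R sib) // (level_siblings hw sib).
rewrite /rwave w1 w2 /= opprK => H.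
under eq_integral => y _.
  have -> : W y * (`|m y| + wave_shift R n)^-1 = 2 * wave_ratio R n * (coef n y * W y).
    by rewrite /coef mulrC !mulrA divff ?mul1r // mulf_neq0 // gt_eqF.
  rewrite EFinM; over.
have cW0 y : 0 <= coef n y * W y by rewrite mulr_ge0 // coef_ge0.
rewrite ge0_integralZl_EFin //; last 3 first.
- by move=> y _; rewrite lee_fin.
- by apply/measurable_EFinP; exact: measurable_funM.
- by rewrite mulr_ge0 // ltW.
by rewrite H -EFinM; congr _%:E; ring.
Qed.

(** An atom at [0] would make the integrals of [wave_pairing] blow up as the shift
    tends to [0]. *)
Lemma zero_spectrum : {ae nu, forall y, m y = 0 -> W y = 0}.
Proof.
pose a y := if m y == 0 then W y else 0.
have a0 y : 0 <= a y by rewrite /a; case: ifP.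
have ma : measurable_fun [set: Y] a.
  apply: measurable_fun_ifT; [|exact: mW|exact: measurable_cst].
  by apply: measurable_fun_eqr => //; exact: measurable_cst.
have aI n : (\int[nu]_y (a y)%:E <= (wave_shift R n * (4 * mu w R x1))%:E)%E.
  have s0 := wave_shift_gt0 R n; have /andP[r0 r1] := ratio_bounds n.
  apply: (@le_trans _ _ ((wave_shift R n)%:E *
      \int[nu]_y (W y * (`|m y| + wave_shift R n)^-1)%:E)%E); last first.
    rewrite wave_pairing -EFinM lee_fin ler_pM2l // ler_piMl ?(ltW r1) //.
    by rewrite mulr_ge0 // ltW.
  have p0 y : 0 <= W y * (`|m y| + wave_shift R n)^-1.
    by rewrite mulr_ge0 // invr_ge0 addr_ge0 // ltW.
  have mp : measurable_fun [set: Y] (fun y => W y * (`|m y| + wave_shift R n)^-1).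
    by apply: measurable_funM => //; exact: measurable_inv_wave_shift.
  rewrite -ge0_integralZl_EFin //; last 3 first.
  - by move=> y _; rewrite lee_fin.
  - exact/measurable_EFinP.
  - exact: ltW.
  apply: ge0_le_integral => //.
  - by move=> y _; rewrite lee_fin.
  - exact/measurable_EFinP.
  - by apply/measurable_EFinP; apply: measurable_funM => //; exact: measurable_cst.
  - move=> y _; rewrite lee_fin /a; case: ifPn => [/eqP ->|_].
      by rewrite normr0 add0r mulrCA divff ?mulr1 // gt_eqF.
    by rewrite mulr_ge0 // ltW.
have aI0 : (\int[nu]_y `|(a y)%:E| = 0)%E.
  under eq_integral do rewrite /= ger0_norm //.
  apply/eqP; rewrite eq_le integral_ge0 ?andbT; last by move=> y _; rewrite lee_fin.
  have lim : (wave_shift R n * (4 * mu w R x1))%:E @[n --> \oo] --> (0 : \bar R)%E.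
    apply: cvg_EFin; first by near=> n.
    rewrite -[X in _ --> X](mul0r (4 * mu w R x1)).
    by apply: cvgM; [exact: cvg_wave_shift|exact: cvg_cst].
  have <- := cvg_lim (@ereal_hausdorff R) lim.
  by apply: lime_ge; [apply/cvg_ex; eexists; exact: lim|exact: nearW].
have /(ae_eq_integral_abs nu measurableT) := aI0.
move=> /(_ ((measurable_EFinP _ _).2 ma)); apply: filterS => y /(_ I) [].
by rewrite /a => + my; rewrite my eqxx.
Unshelve. all: by end_near. Qed.

(** Almost everywhere equal to [W]; with it, the pointwise conditions of the limit
    theorems hold everywhere. *)
Let V y : R := if 0 < m y then W y else 0.

Let V0 y : 0 <= V y. Proof. by rewrite /V; case: ifP. Qed.

Let mV : measurable_fun [set: Y] V.
Proof.
apply: measurable_fun_ifT; [|exact: mW|exact: measurable_cst].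
by apply: measurable_fun_ltr => //; exact: measurable_cst.
Qed.

Let Vm y : V y != 0 -> 0 < `|m y|.
Proof. by rewrite /V; case: ifP => [m0 _|_ /eqP//]; rewrite normr_gt0 gt_eqF. Qed.

Let VW : {ae nu, forall y, V y = W y}.
Proof.
have N2 := negative_spectrum hq hw hU gL.
apply: filterS2 zero_spectrum N2 => y z0 n0; rewrite /V.
have [/n0 e|//|/z0 ->//] := ltgtP (m y) 0.
by rewrite /W /density e Normc.normc0 expr0n.
Qed.

Let resolvent n : (\int[nu]_y (V y * (`|m y| + wave_shift R n)^-1)%:E =
  (wave_ratio R n * (4 * mu w R x1))%:E)%E.
Proof.
rewrite -wave_pairing; apply: ae_eq_integral => //.
- by apply/measurable_EFinP/measurable_funM => //; exact: measurable_inv_wave_shift.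
- by apply/measurable_EFinP/measurable_funM => //; exact: measurable_inv_wave_shift.
- by apply: filterS VW => y -> _.
Qed.

Let inv_sqrt_nonpos y : m y <= 0 -> inv_sqrt (m y) = 0.
Proof. by move=> m0; rewrite /inv_sqrt ler0_sqrtr // invr0. Qed.

Let inv_sqrt_sqr y : inv_sqrt (m y) ^+ 2 * W y = V y * `|m y|^-1.
Proof.
rewrite /V; case: ltP => m0; last by rewrite inv_sqrt_nonpos // expr0n !mul0r.
by rewrite /inv_sqrt exprVn sqr_sqrtr ?ltW // gtr0_norm // mulrC.
Qed.

Let inv_sqrt_abs y : V y * inv_sqrt `|m y| = W y * inv_sqrt (m y).
Proof.
rewrite /V; case: ltP => m0; last by rewrite inv_sqrt_nonpos // mul0r mulr0.
by rewrite gtr0_norm.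
Qed.

(** The multiplier [inv_sqrt m] sends the wave into [L^2] because [V / m] is
    integrable, by [integral_resolvent0]. The integral is the pairing of the
    resulting [h] with the dipole. *)
Lemma wave_inverse_root n : exists2 h, functional_calculus w nu m U (@inv_sqrt R) (rwave n) h &
  (\int[nu]_y (V y * inv_sqrt `|m y| * (`|m y| + wave_shift R n)^-1)%:E =
   (2 * wave_ratio R n * mu w R x1 * (complex.Re (h x1) - complex.Re (h x2)))%:E)%E.
Proof.
have /andP[r0 r1] := ratio_bounds n; have s0 := wave_shift_gt0 R n.
have ma := measurable_inv_sqrt mm.
have c0 y : 0 <= coef n y := coef_ge0 n y.
pose c := (2 * wave_ratio R n)^-1 * (wave_shift R n)^-1.
have cc y : coef n y <= c.
  rewrite ler_wpM2l ?invr_ge0 ?mulr_ge0 ?(ltW r0) //.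
  by rewrite lef_pV2 ?posrE ?lerDr // ltr_wpDl.
have Vi0 y : 0 <= V y * `|m y|^-1 by rewrite mulr_ge0 // invr_ge0.
have mVi : measurable_fun [set: Y] (fun y => V y * `|m y|^-1).
  by apply: measurable_funM => //; exact: measurable_inv_ge0.
have [|h hL e] := inL2_multiplier hU (rwaveL n) ma.
  apply: (@le_lt_trans _ _ (\int[nu]_y ((c ^+ 2)%:E * (V y * `|m y|^-1)%:E))%E).
    apply: ae_ge0_le_integral => //.
    - by move=> y _; rewrite lee_fin mulr_ge0 ?sqr_ge0 ?density_ge0.
    - apply/measurable_EFinP/measurable_funM; first exact: measurable_funX.
      exact: (measurable_density hU (rwaveL n)).
    - by move=> y _; rewrite -EFinM lee_fin mulr_ge0 ?sqr_ge0.
    - by apply/measurable_EFinP; apply: measurable_funM => //; exact: measurable_cst.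
    apply: filterS (spectral_wave n) => y e _; rewrite -EFinM lee_fin.
    rewrite /density e normc2M normc2R -/(density U g y) -/(W y) mulrCA inv_sqrt_sqr.
    by rewrite ler_wpM2r // lerXn2r ?nnegrE // (le_trans (c0 y)).
  rewrite ge0_integralZl_EFin ?sqr_ge0 //; last 2 first.
  - by move=> y _; rewrite lee_fin.
  - exact/measurable_EFinP.
  by rewrite (integral_resolvent0 mabs (fun y => normr_ge0 _) mV V0 Vm resolvent) -EFinM ltry.
exists h => //.
have e' : {ae nu, forall y, U h y = (inv_sqrt (m y) * coef n y)%:C * U g y}.
  apply: filterS2 e (spectral_wave n) => y -> ->.
  by rewrite mulrA -(rmorphM (real_complex R)).
have mac : measurable_fun [set: Y] (fun y => inv_sqrt (m y) * coef n y).
  exact: measurable_funM.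
have := spectral_pairing hL mac e' => H.
rewrite -mulrA EFinM -H -ge0_integralZl_EFin //; last 3 first.
- by move=> y _; rewrite lee_fin mulr_ge0 // mulr_ge0 // invr_ge0 sqrtr_ge0.
- by apply/measurable_EFinP; exact: measurable_funM.
- by rewrite mulr_ge0 // ltW.
apply: eq_integral => y _; rewrite -EFinM; congr _%:E; rewrite inv_sqrt_abs /coef.
rewrite [RHS](_ : _ = W y * inv_sqrt (m y) * ((2 * wave_ratio R n) *
  (2 * wave_ratio R n)^-1) * (`|m y| + wave_shift R n)^-1); last by ring.
by rewrite divff ?mulr1 // mulf_neq0 // gt_eqF.
Qed.

(** The waves are bounded by [1], so a bound on the Riesz transform would bound
    their [BMO] norms, hence by [sibling_oscillation] the pairings of
    [wave_inverse_root], contrary to [integral_inv_sqrt_unbounded]. *)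
Lemma riesz_not_bounded (Rz : (T -> R[i]) -> (T -> R[i])) :
  riesz_transform w nu m U Rz ->
  ~ exists C : R, forall f, inL2 w f -> inLinf f ->
      (normBMO w (Rz f) <= C%:E * normLinf f)%E.
Proof.
move=> [_ hRz] [C HC].
have [c c_gt0 osc] := sibling_oscillation R hq hw sib.
apply: (integral_inv_sqrt_unbounded mabs (fun y => normr_ge0 _) mV V0 Vm resolvent).
  by rewrite mulr_gt0.
exists (2 * mu w R x1 * (`|C| / c)) => n.
have /andP[r0 r1] := ratio_bounds n.
have [h fc ->] := wave_inverse_root n.
have linf1 : (normLinf (rwave n) <= 1)%E.
  apply: ge_ereal_sup => _ [x _ <-]; rewrite lee_fin normcR.
  by apply: wave_norm => //; rewrite (ltW r0) ltW.
have linf0 : (0 <= normLinf (rwave n))%E.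
  by apply: le_trans (ereal_sup_ubound (ex_intro2 _ _ x1 I erefl)); rewrite lee_fin normc_ge0.
have bmo : (normBMO w (Rz (rwave n)) <= `|C|%:E)%E.
  have linf : inLinf (rwave n) by apply: le_lt_trans linf1 _; exact: ltry.
  apply: le_trans (HC _ (rwaveL n) linf) _.
  apply: (@le_trans _ _ (`|C|%:E * normLinf (rwave n))%E).
    by rewrite lee_wpmul2r // lee_fin ler_norm.
  by rewrite -[leRHS]mule1 lee_wpmul2l // lee_fin.
have := le_trans (osc (Rz (rwave n))) bmo.
rewrite (hRz _ _ fc) /gradient (siblings_predecessor sib) opprB addrA subrK lee_fin.
move=> H; rewrite lee_fin.
set D := complex.Re _ - complex.Re _.
have DC : D <= `|C| / c.
  rewrite ler_pdivlMr // mulrC; apply: le_trans H; rewrite ler_pM2l //.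
  rewrite /D; case: (h x1) (h x2) => [a1 b1] [a2 b2] /=.
  rewrite (le_trans (ler_norm _)) // -sqrtr_sqr ler_wsqrtr // lerDl sqr_ge0.
  by [].
have C0 : 0 <= `|C| / c by rewrite divr_ge0 // ltW.
set K := `|C| / c in DC C0 *; set r := wave_ratio R n in r0 r1 *.
have rD : r * D <= K.
  apply: (@le_trans _ _ (r * K)); first by rewrite ler_pM2l.
  by rewrite ler_piMl // ltW.
rewrite (_ : 2 * r * mu w R x1 * D = 2 * mu w R x1 * (r * D)); last by ring.
by rewrite ler_wpM2l // mulr_ge0 // ltW.
Qed.

End RieszSiblings.

Theorem proposition4p4 (R : realType) (q : nat) (hq : (2 <= q)%N)
    (T : homTree q) (w : nat -> T) (hw : geodesic_ray w)
    (d : measure_display) (Y : measurableType d)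
    (nu : {measure set Y -> \bar R}) (m : Y -> R)
    (U : (T -> R[i]) -> (Y -> R[i]))
    (hU : diagonalizes w nu m U (flow_laplacian w (R := R)))
    (Rz : (T -> R[i]) -> (T -> R[i]))
    (hRz : riesz_transform w nu m U Rz) :
  ~ exists C : R, forall f : T -> R[i], inL2 w f -> inLinf f ->
      (normBMO w (Rz f) <= C%:E * normLinf f)%E.
Proof.
have [x1 [x2 sib]] : exists x1 x2, siblings w x1 x2.
  have := size_successors hw (w 0); have := successors_uniq w (w 0).
  have mem := mem_successors hw (w 0).
  case: (successors w (w 0)) mem => [|x1 [|x2 s]] mem; first by move=> _ e; rewrite -e in hq.
    by move=> _ e; rewrite -e in hq.
  rewrite /= inE negb_or => /andP[/andP[x12 _] _] _; exists x1, x2; split; first by rewrite x12.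
  have /eqP -> : predecessor w x1 == w 0 by rewrite -mem mem_head.
  by apply/esym/eqP; rewrite -mem !inE eqxx orbT.
exact: (riesz_not_bounded hq hw hU sib hRz).
Qed.
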